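(* Let $n\ge1$, let $N\ge0$ be an integer, and let $a,b,c,d,g,x_1,\dots,x_n,y_1,\dots,y_{n-1}$ be complex parameters. Let $q,\tilde q$ be two bases and $p,\tilde p$ two nomes. Then \begin{align*} &\sum_{\substack{0\le|\boldsymbol k|\le N\\ k_1,\dots,k_n\ge0}}\Bigg(\prod_{1\le r<s\le n}\frac{\theta(q^{k_r-k_s}x_r/x_s;p)}{\theta(x_r/x_s;p)\,(x_rx_s;q,p)_{k_r+k_s}}\prod_{s=1}^{n-1}\frac{\prod_{r=1}^n(x_ry_s,\,x_r/y_s;q,p)_{k_r}}{(gy_s,\,g/y_s;q,p)_{|\boldsymbol k|}}\\ &\quad\times\prod_{r=1}^n\frac{(gx_r;q,p)_{|\boldsymbol k|}\,(g/x_r;q,p)_{|\boldsymbol k|-k_r}}{(gx_r;q,p)_{k_r}\prod_{s=1}^n(qx_r/x_s;q,p)_{k_r}}\cdot q^{\sum_{r=1}^n(r-1)k_r}\,(q;q,p)_{|\boldsymbol k|}\\ &\quad\times\frac{\theta(a\tilde q^{2|\boldsymbol k|};\tilde p)}{\theta(a;\tilde p)}\,\frac{(a,\,b,\,c,\,d,\,a^2\tilde q^{1+N}/(bcd),\,\tilde q^{-N};\tilde q,\tilde p)_{|\boldsymbol k|}}{(\tilde q,\,a\tilde q/b,\,a\tilde q/c,\,a\tilde q/d,\,bcd\tilde q^{-N}/a,\,a\tilde q^{N+1};\tilde q,\tilde p)_{|\boldsymbol k|}}\,\tilde q^{|\boldsymbol k|}\Bigg)\\ &=\frac{(a\tilde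 q,\,a\tilde q/(bc),\,a\tilde q/(bd),\,a\tilde q/(cd);\tilde q,\tilde p)_N}{(a\tilde q/b,\,a\tilde q/c,\,a\tilde q/d,\,a\tilde q/(bcd);\tilde q,\tilde p)_N}. \end{align*}
   Context: The numbers $q,\tilde q,p,\tilde p$ are complex with $q,\tilde q\neq 0$ and $|p|,|\tilde p|<1$; the pairs $(q,p)$ and $(\tilde q,\tilde p)$ are independent of each other. For $a\ne 0$ put $\theta(a;p)=\prod_{j\ge 0}(1-ap^j)(1-p^{j+1}/a)$. For an integer $k\ge 0$ the $q,p$-shifted factorial is $(a;q,p)_k=\prod_{j=0}^{k-1}\theta(aq^j;p)$ (empty product $=1$), and similarly with $(\tilde q,\tilde p)$ in place of $(q,p)$. Write $(a_1,\dots,a_m;q,p)_k=(a_1;q,p)_k\cdots(a_m;q,p)_k$. For a tuple $\boldsymbol k=(k_1,\dots,k_n)$, $|\boldsymbol k|=k_1+\cdots+k_n$. All parameters are nonzero and generic in the sense that no denominators in the formula vanish. *)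

(* Defs.v *)
From HB Require Import structures.
From mathcomp Require Import all_boot all_order all_algebra.
From mathcomp Require Import complex.
From mathcomp Require Import boolp classical_sets reals topology normedtype.
From mathcomp Require Import sequences.

Set Implicit Arguments.
Unset Strict Implicit.
Unset Printing Implicit Defensive.

Import Order.TTheory GRing.Theory Num.Theory.
Import numFieldNormedType.Exports.

Local Open Scope ring_scope.
Local Open Scope classical_set_scope.

(* theta(a; p) for a != 0 and `|p| < 1.  The alias R[i]^o carries the topology
   of the complex modulus; since 0 ^+ 0 = 1, p = 0 gives theta(a; 0) = 1 - a. *)
Definition theta (R : realType) (a p : R[i]) : R[i] :=
  limn (fun m : nat =>
    \prod_(0 <= j < m) ((1 - a * p ^+ j) * (1 - p ^+ j.+1 / a)) : R[i]^o).

Definition qpfact (R : realType) (a q p : R[i]) (k : nat) : R[i] :=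
  \prod_(0 <= j < k) theta (a * q ^+ j) p.

(* (a_1, ..., a_m; q, p)_k *)
Definition qpfacts (R : realType) (s : seq R[i]) (q p : R[i]) (k : nat) : R[i] :=
  \prod_(a <- s) qpfact a q p k.

(* |k| = k_1 + ... + k_n.  A tuple of naturals with |k| <= N has all its entries
   at most N, so the tuples in the summation range are finite functions into
   'I_N.+1. *)
Definition weight (n N : nat) (k : {ffun 'I_n -> 'I_N.+1}) : nat :=
  (\sum_(r < n) k r)%N.

(* Main.v *)
Require Import Defs.
From HB Require Import structures.
From mathcomp Require Import all_boot all_order all_algebra.
From mathcomp Require Import complex.
From mathcomp Require Import boolp classical_sets reals topology normedtype.
From mathcomp Require Import sequences.
From mathcomp Require Import exp finmap ring lra zify.

Set Implicit Arguments.
Unset Strict Implicit.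
Unset Printing Implicit Defensive.

Import Order.TTheory GRing.Theory Num.Theory.
Import numFieldNormedType.Exports.

Local Open Scope ring_scope.

(** The two bases do not interact.  The summand is a product of a factor
in [q, p] that depends on the whole tuple [k] and a factor in [qt, pt] that
depends only on [m = |k|].  For every [m] the first factors add up to [1]
over all tuples with [|k| = m] ([inner_sum]), so the multiple sum collapses to
the single sum over [m] of the second factors, which is the elliptic
Jackson summation of Frenkel and Turaev ([frenkel_turaev]).

Both identities, and so the whole theorem ([bibasic_sum]), hold for any
functions [f] on a field that satisfy [f 1 = 0], [f (1/a) = - f a / a] and one
three-term relation ([theta_law]).

- [frenkel_turaev] is summation by parts.  The three-term relation writes the
  summand as a difference [u_k - v_k], and the shifted difference
  [u_k - v_(k+1)] is again a summand, with [a] replaced by [a q] and [N] by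
  [N - 1].  No division by an uncontrolled factor occurs.

- [inner_sum] is a statement about a random walk on tuples.  There are weights
  [P(k, r)] for the step from [k] to [k + e_r] and weights [Q(k, r)] for the
  reverse step into [k] such that
  [t(k) P(k, r) = t(k + e_r) Q(k + e_r, r)]  ([inner_term_step]), where [t] is the
  first factor.  Summed over [r] both families of weights give [1]: for [P] this is
  Lagrange interpolation for products of [f (g y) f (g / y)]
  ([theta_lagrange]), for [Q] it is the elliptic partial fraction
  expansion ([theta_interpolation]).  Hence the total over [|k| = m] does
  not depend on [m], and it is [1] for [m = 0].

It remains to prove the three-term relation for the infinite product
[theta] (a sqrt-free form of the addition formula of Weierstrass), without
complex analysis.  The finite form of the Jacobi triple product and dominated
convergence give [theta x = kappa * T x] with
[T x = sum over the integers of p^(k(k-1)/2) (-x)^k] ([theta_jacobi]).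
Splitting the double series [T (x y) T (x / y)] by the parity of the sum of the
two indices separates the variables,
[theta (x y) theta (x / y) = A x * B y - x / y * (B x * A y)]  ([theta_split]),
and for such expressions the relation is the Pluecker relation between
[2 x 2] minors. *)

(** * Theta laws and shifted factorials *)

(* Solves field equations whose denominators are products of terms that are
   known, by hypotheses, not to vanish. *)
Ltac field_nz :=
  field; repeat (apply/andP; split);
  first [assumption
        | rewrite ?oppr_eq0 ?mulf_eq0 ?negb_or; repeat (apply/andP; split);
          first [assumption | apply: expf_neq0; assumption]].

(** [law3] is the addition formula of Weierstrass for theta functions, which
is usually written in terms of [x y], [x / y], [u v], [u / v] and so on; here
[Q = x v], [b = 1 / (y v)], [c = y / v] and [d = u / x].  In these variables the
applications need no square roots. *)
Record theta_law (F : fieldType) (f : F -> F) : Prop := ThetaLaw {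
  law1 : f 1 = 0;
  lawV : forall a, a != 0 -> f a^-1 = - (f a / a);
  law3 : forall Q b c d, Q != 0 -> b != 0 -> c != 0 -> d != 0 ->
    f (b * c * d * Q) * f (b * Q) * f (c * Q) * f (d * Q)
    - f Q * f (c * d * Q) * f (b * d * Q) * f (b * c * Q)
    = Q * f (b * c * d * Q ^+ 2) * f b * f c * f d
}.

Definition shifted (F : fieldType) (f : F -> F) (a q : F) (k : nat) : F :=
  \prod_(0 <= j < k) f (a * q ^+ j).

Lemma shifted0 (F : fieldType) (f : F -> F) a q : shifted f a q 0 = 1.
Proof. by rewrite /shifted big_geq. Qed.

Lemma shiftedSr (F : fieldType) (f : F -> F) a q k :
  shifted f a q k.+1 = shifted f a q k * f (a * q ^+ k).
Proof. by rewrite /shifted big_nat_recr. Qed.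

Lemma shiftedSl (F : fieldType) (f : F -> F) a q k :
  shifted f a q k.+1 = f a * shifted f (a * q) q k.
Proof.
rewrite /shifted big_nat_recl // expr0 mulr1; congr (_ * _).
by apply: eq_bigr => j _; rewrite exprS mulrA.
Qed.

Lemma shifted_neq0 (F : fieldType) (f : F -> F) a q k :
  (forall j, (j < k)%N -> f (a * q ^+ j) != 0) <-> shifted f a q k != 0.
Proof.
elim: k => [|k [IH1 IH2]]; first by rewrite shifted0 oner_eq0.
rewrite shiftedSr mulf_eq0 negb_or; split=> [h|/andP[h1 h2] j].
  by rewrite h // andbT; apply: IH1 => j jk; apply: h; apply: ltnW.
by rewrite ltnS leq_eqVlt => /orP[/eqP->//|]; apply: IH2.
Qed.

(** * The elliptic Jackson summation of Frenkel and Turaev *)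

Section FrenkelTuraev.
Variables (F : fieldType) (f : F -> F) (q : F).
Hypotheses (L : theta_law f) (q_neq0 : q != 0).

Local Notation ph a k := (shifted f a q k).

(** The very-well-poised factor
[f (a q^(2k)) / f a * (a; q)_k], with [f a] cancelled, so that passing from
[a] to [a q] introduces no new denominator. *)
Definition vwp_weight (a : F) (k : nat) : F :=
  if k is j.+1 then f (a * q ^+ (2 * k)) * ph (a * q) j else 1.

Definition vwp_term (a b c d e : F) (N k : nat) : F :=
  vwp_weight a k *
  (ph b k * ph c k * ph d k * ph e k * ph (q ^- N) k /
   (ph q k * ph (a * q / b) k * ph (a * q / c) k * ph (a * q / d) k
    * ph (a * q / e) k * ph (a * q ^+ N.+1) k)) * q ^+ k.

(** The two products that summation by parts compares.  With
[h = b c d / (a q)], [A_k = (aq, eq, q^(-N), hq)_k / (q, aq/e, a q^(N+2), aq/h)_k]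
and [B_k = (b, c, d, aq/h)_k / (aq/b, aq/c, aq/d, h)_k], these are
[A_k B_k] and [A_(k-1) B_k]; the factors [(aq/h)_k], which may vanish, are
cancelled beforehand. *)
Definition abel_up (a b c d e : F) (N k : nat) : F :=
  let h := b * c * d / (a * q) in
  ph (a * q) k * ph (e * q) k * ph (q ^- N) k * ph b k * ph c k * ph d k
  / (ph q k * ph (a * q / e) k * ph (a * q ^+ N.+2) k
     * ph (a * q / b) k * ph (a * q / c) k * ph (a * q / d) k)
  * f (h * q ^+ k) / f h.

Definition abel_down (a b c d e : F) (N k : nat) : F :=
  let h := b * c * d / (a * q) in
  if k is j.+1 then
  ph (a * q) j * ph (e * q) j * ph (q ^- N) j * ph b k * ph c k * ph d k
  / (ph q j * ph (a * q / e) j * ph (a * q ^+ N.+2) j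
     * ph (a * q / b) k * ph (a * q / c) k * ph (a * q / d) k)
  * f (a * q ^+ k / h) / f h
  else 0.

(** The difference [A_k - A_(k-1)] factors: this is [law3] with [Q = q^k] and
[b, c, d] equal to [e], [q^(-N-1)], [h], whose product is [a]. *)
Lemma vwp_term_split (a b c d e : F) N k :
  a != 0 -> b != 0 -> c != 0 -> d != 0 -> e != 0 ->
  b * c * d * e = a ^+ 2 * q ^+ N.+2 ->
  f (b * c * d / (a * q)) != 0 ->
  ph q k != 0 -> ph (a * q / b) k != 0 -> ph (a * q / c) k != 0 ->
  ph (a * q / d) k != 0 -> ph (a * q / e) k != 0 ->
  ph (a * q ^+ N.+2) k != 0 ->
  vwp_term a b c d e N.+1 k = abel_up a b c d e N k - abel_down a b c d e N k.
Proof.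
move=> a0 b0 c0 d0 e0 bal hh.
case: k => [|k].
  move=> _ _ _ _ _ _; rewrite /vwp_term /abel_up /abel_down /vwp_weight !shifted0 expr0 !mulr1.
  by rewrite subr0 mul1r mulfK.
move=> nq nb nc nd ne nN.
rewrite /vwp_term /abel_up /abel_down /vwp_weight.
set h := b * c * d / (a * q) in hh *.
have h0 : h != 0 by rewrite mulf_neq0 ?invr_neq0 ?mulf_neq0.
rewrite (shiftedSl f e) (shiftedSl f (q ^- N.+1)).
have qN0 : q ^+ N != 0 by rewrite expf_neq0.
have -> : q ^- N.+1 * q = q ^- N by rewrite exprSr; field; rewrite q_neq0 qN0.
have Q0 : q ^+ k.+1 != 0 by rewrite expf_neq0.
have := law3 L Q0 e0 (_ : q ^- N.+1 != 0) h0.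
rewrite invr_eq0 expf_neq0 // => /(_ isT).
have beq : e = a ^+ 2 * q ^+ N.+2 / (b * c * d) by rewrite -bal; field; rewrite b0 c0 d0.
have -> : e * q ^- N.+1 * h = a.
  by rewrite beq /h !exprS; field; rewrite a0 b0 c0 d0 q_neq0 qN0.
have -> : e * q ^+ k.+1 = e * q * q ^+ k by rewrite exprS mulrA.
have -> : q ^- N.+1 * q ^+ k.+1 = q ^- N * q ^+ k by rewrite !exprS; field; rewrite qN0.
have -> : q ^- N.+1 * h * q ^+ k.+1 = a * q / e * q ^+ k.
  by rewrite beq /h !exprS; field; rewrite a0 b0 c0 d0 q_neq0 qN0.
have -> : e * h * q ^+ k.+1 = a * q ^+ N.+2 * q ^+ k.
  by rewrite beq /h !exprS; field; rewrite a0 b0 c0 d0 q_neq0.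
have -> : e * q ^- N.+1 * q ^+ k.+1 = a * q ^+ k.+1 / h.
  by rewrite beq /h !exprS; field; rewrite a0 b0 c0 d0 q_neq0 qN0.
rewrite -exprM mulnC.
have -> : a * q ^+ k.+1 = a * q * q ^+ k by rewrite exprS mulrA.
have -> : f (q ^+ k.+1) = f (q * q ^+ k) by rewrite exprS.
move: nq ne nN; rewrite (shiftedSr _ q) (shiftedSr _ (a * q / e)) (shiftedSr _ (a * q ^+ N.+2)).
rewrite (shiftedSr _ (a * q)) (shiftedSr _ (e * q)) (shiftedSr _ (q ^- N)).
rewrite !mulf_eq0 !negb_or => /andP[nq1 nq2] /andP[ne1 ne2] /andP[nN1 nN2] E.
set Q := q ^+ k.+1 in E *.
move: nb nc nd hh nq1 nq2 ne1 ne2 nN1 nN2 E.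
move: (ph (a * q / b) k.+1) (ph (a * q / c) k.+1) (ph (a * q / d) k.+1)
  (f h) (ph q k) (f (q * q ^+ k)) (ph (a * q / e) k) (f (a * q / e * q ^+ k))
  (ph (a * q ^+ N.+2) k) (f (a * q ^+ N.+2 * q ^+ k)) => x1 x2 x3 x4 x5 x6 x7 x8 x9 x10.
move=> ? ? ? ? ? ? ? ? ? ? E.
transitivity (ph (a * q) k * ph (e * q) k * ph (q ^- N) k * ph b k.+1 * ph c k.+1 * ph d k.+1
   / (x5 * x6 * x7 * x8 * x9 * x10 * x1 * x2 * x3 * x4) *
   (Q * f (a * q ^+ (2 * k.+1)) * f e * f (q ^- N.+1) * x4)).
  by field_nz.
by rewrite -E; field_nz.
Qed.

Lemma vwp_weight_shift a k :
  f a * vwp_weight a k = f (a * q ^+ (2 * k)) * ph a k.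
Proof.
case: k => [|k]; first by rewrite muln0 expr0 mulr1 shifted0.
by rewrite /vwp_weight shiftedSl mulrCA.
Qed.

Lemma vwp_weightE a k : f a != 0 ->
  f (a * q ^+ (2 * k)) / f a * ph a k = vwp_weight a k.
Proof.
move=> fa; case: k => [|k]; first by rewrite muln0 expr0 mulr1 divff // shifted0 mulr1.
by rewrite shiftedSl mulrA divfK.
Qed.

(** The difference [B_k - B_(k+1)] factors as well, and what results is a summand
for [a q], [e q] and [N] instead of [a], [e] and [N + 1]. *)
Lemma abel_shift (a b c d e : F) N k :
  a != 0 -> b != 0 -> c != 0 -> d != 0 -> e != 0 ->
  f (a * q / (b * c * d)) != 0 ->
  ph q k != 0 -> ph (a * q / b) k.+1 != 0 -> ph (a * q / c) k.+1 != 0 ->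
  ph (a * q / d) k.+1 != 0 -> ph (a * q / e) k != 0 ->
  ph (a * q ^+ N.+2) k != 0 ->
  abel_up a b c d e N k - abel_down a b c d e N k.+1 =
  f (a * q) * f (a * q / (b * c)) * f (a * q / (b * d)) * f (a * q / (c * d))
  / (f (a * q / b) * f (a * q / c) * f (a * q / d) * f (a * q / (b * c * d)))
  * vwp_term (a * q) b c d (e * q) N k.
Proof.
move=> a0 b0 c0 d0 e0 hh nq nb nc nd ne nN.
rewrite /vwp_term /abel_up /abel_down.
have Q0 : q ^+ k != 0 by rewrite expf_neq0.
have qN0 : q ^+ N != 0 by rewrite expf_neq0.
(* [law3] with [Q = b q^k] and [b, c, d] equal to [aq/(bc)], [aq/(bd)],
   [cd/(aq)]. *)
have n1 : b * q ^+ k != 0 by rewrite mulf_neq0.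
have n2 : a * q / (b * c) != 0 by rewrite !mulf_neq0 ?invr_eq0 ?mulf_neq0.
have n3 : a * q / (b * d) != 0 by rewrite !mulf_neq0 ?invr_eq0 ?mulf_neq0.
have n4 : c * d / (a * q) != 0 by rewrite !mulf_neq0 ?invr_eq0 ?mulf_neq0.
have := law3 L n1 n2 n3 n4.
have -> : a * q / (b * c) * (a * q / (b * d)) * (c * d / (a * q)) * (b * q ^+ k)
  = a * q / b * q ^+ k by field; rewrite a0 b0 c0 d0 q_neq0.
have -> : a * q / (b * c) * (b * q ^+ k) = a * q / c * q ^+ k
  by field; rewrite b0 c0.
have -> : a * q / (b * d) * (b * q ^+ k) = a * q / d * q ^+ k
  by field; rewrite b0 d0.
have -> : c * d / (a * q) * (b * q ^+ k) = b * c * d / (a * q) * q ^+ k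
  by field; rewrite a0 q_neq0.
have -> : a * q / (b * d) * (c * d / (a * q)) * (b * q ^+ k) = c * q ^+ k
  by field; rewrite a0 b0 d0 q_neq0.
have -> : a * q / (b * c) * (c * d / (a * q)) * (b * q ^+ k) = d * q ^+ k
  by field; rewrite a0 b0 c0 q_neq0.
have -> : a * q / (b * c) * (a * q / (b * d)) * (b * q ^+ k)
    = a * q ^+ k.+1 / (b * c * d / (a * q))
  by rewrite exprS; field; rewrite a0 b0 c0 d0 q_neq0.
have -> : a * q / (b * c) * (a * q / (b * d)) * (c * d / (a * q)) * (b * q ^+ k) ^+ 2
   = a * q * q ^+ (2 * k)
  by rewrite mulnC exprM; field; rewrite a0 b0 c0 d0 q_neq0.
have -> : f (c * d / (a * q)) = - (f (a * q / (c * d)) / (a * q / (c * d))).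
  by rewrite -(lawV L) ?invf_div ?mulf_neq0 // ?invr_eq0 ?mulf_neq0.
have hV : f (b * c * d / (a * q)) = - (f (a * q / (b * c * d)) / (a * q / (b * c * d))).
  by rewrite -(lawV L) ?invf_div ?mulf_neq0 // ?invr_eq0 ?mulf_neq0.
rewrite {}hV => E.
have W := vwp_weight_shift (a * q) k.
have -> : a * q * q / (e * q) = a * q / e by field; rewrite e0 q_neq0.
have -> : a * q * q ^+ N.+1 = a * q ^+ N.+2 by rewrite (exprS _ N.+1) mulrA.
move: nb nc nd.
have -> : a * q * q / b = a * q / b * q by ring.
have -> : a * q * q / c = a * q / c * q by ring.
have -> : a * q * q / d = a * q / d * q by ring.
rewrite ![ph _ k.+1]shiftedSr => nb nc nd.
have sh (z : F) : ph z k * f (z * q ^+ k) != 0 -> [/\ ph z k != 0,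
     f (z * q ^+ k) != 0, f z != 0 & ph (z * q) k = ph z k * f (z * q ^+ k) / f z].
  move=> nz; have := nz; rewrite mulf_eq0 negb_or => /andP[? ?].
  have E2 := shiftedSl f z q k; rewrite shiftedSr in E2.
  have nfz : f z != 0 by move: nz; rewrite E2 mulf_eq0 negb_or => /andP[].
  by split=> //; rewrite E2 mulrAC mulfV // mul1r.
case/sh: nb => nb1 nb2 nb3 ->; case/sh: nc => nc1 nc2 nc3 ->; case/sh: nd => nd1 nd2 nd3 ->.
have aq0 : a * q != 0 by rewrite mulf_neq0.
move: E W nb2 nc2 nd2 hh nq ne nN.
move: (f (a * q / b * q ^+ k)) (f (a * q / c * q ^+ k)) (f (a * q / d * q ^+ k))
  (f (b * c * d / (a * q) * q ^+ k)) (f (a * q ^+ k.+1 / (b * c * d / (a * q))))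
  (f (a * q * q ^+ (2 * k))) (f (a * q / (b * c * d)))
  (f (a * q / (b * c))) (f (a * q / (b * d))) (f (a * q / (c * d)))
  => gb gc gd g1 g2 g3 g4 fbc fbd fcd E W *.
pose K := ph (a * q) k * ph (e * q) k * ph (q ^- N) k * ph b k * ph c k * ph d k /
  (ph q k * ph (a * q / e) k * ph (a * q ^+ N.+2) k * (ph (a * q / b) k * gb) *
   (ph (a * q / c) k * gc) * (ph (a * q / d) k * gd)) / - (g4 / (a * q / (b * c * d))).
pose K' := fbc * fbd * fcd / g4 *
   (ph b k * ph c k * ph d k * ph (e * q) k * ph (q ^- N) k /
    (ph q k * (ph (a * q / b) k * gb) * (ph (a * q / c) k * gc) *
     (ph (a * q / d) k * gd) * ph (a * q / e) k * ph (a * q ^+ N.+2) k)) * q ^+ k.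
transitivity (K' * (f (a * q) * vwp_weight (a * q) k)); last by rewrite /K'; field_nz.
rewrite W; move: E => /(congr1 ( *%R K)) E.
transitivity (K * (gb * gc * gd * g1 -
   f (b * q ^+ k) * f (c * q ^+ k) * f (d * q ^+ k) * g2)); first by rewrite /K; field_nz.
by rewrite E /K /K'; field_nz.
Qed.

(** Inversion turns the factors of [(q^(-N)/z; q)_N] into those of
[(z q; q)_N] in reverse order. *)
Lemma shifted_reflect (z : F) N :
  z != 0 -> (forall j, (j < N)%N -> f (z * q ^+ j.+1) != 0) ->
  ph (q ^- N / z) N != 0.
Proof.
move=> z0 h; apply/shifted_neq0 => j jN.
have qN0 n : q ^+ n != 0 by rewrite expf_neq0.
have := h (N - j.+1)%N ltac:(lia); rewrite subnSK //.
have -> : q ^- N / z * q ^+ j = (z * q ^+ (N - j))^-1.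
  have -> : q ^+ N = q ^+ (N - j) * q ^+ j by rewrite -exprD subnK // ltnW.
  by field; rewrite z0 !qN0.
move=> hf; rewrite (lawV L) ?mulf_neq0 // oppr_eq0 mulf_neq0 //.
by rewrite invr_eq0 mulf_neq0.
Qed.

(** Only [a] and the dependent parameter [e] move in the induction on [N]; a step
multiplies both sides by the same quotient [rho] of theta factors. *)
Theorem frenkel_turaev (N : nat) (a b c d : F) :
  a != 0 -> b != 0 -> c != 0 -> d != 0 ->
  ph q N != 0 -> ph (a * q / b) N != 0 -> ph (a * q / c) N != 0 ->
  ph (a * q / d) N != 0 -> ph (a * q / (b * c * d)) N != 0 ->
  ph (a * q ^+ N.+1) N != 0 ->
  \sum_(0 <= k < N.+1)
     vwp_term a b c d (a ^+ 2 * q ^+ N.+1 / (b * c * d)) N k =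
  ph (a * q) N * ph (a * q / (b * c)) N * ph (a * q / (b * d)) N
    * ph (a * q / (c * d)) N
  / (ph (a * q / b) N * ph (a * q / c) N * ph (a * q / d) N
    * ph (a * q / (b * c * d)) N).
Proof.
elim: N a => [|N IH] a a0 b0 c0 d0 nq nb nc nd nbcd nN.
  rewrite big_nat1 /vwp_term /vwp_weight !shifted0 expr0.
  by rewrite !mulr1 !mul1r.
set e := a ^+ 2 * _ / _.
have bcd0 : b * c * d != 0 by rewrite !mulf_neq0.
have qN0 n : q ^+ n != 0 by rewrite expf_neq0.
have e0 : e != 0.
  rewrite /e mulf_neq0 ?invr_eq0 // mulf_neq0 ?expf_neq0 //.
have bal : b * c * d * e = a ^+ 2 * q ^+ N.+2 by rewrite mulrC mulfVK.
have sub (z : F) n m : (m <= n)%N -> ph z n != 0 -> ph z m != 0.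
  move=> mn /shifted_neq0 h; apply/shifted_neq0 => j jm; apply: h.
  exact: leq_trans mn.
have ne : ph (a * q / e) N.+1 != 0.
  have -> : a * q / e = q ^- N.+1 / (a / (b * c * d)).
    rewrite /e (exprS _ N.+1); field.
    by rewrite a0 b0 c0 d0 q_neq0 qN0.
  apply: shifted_reflect => [|j jN]; first by rewrite mulf_neq0 ?invr_eq0.
  have -> : a / (b * c * d) * q ^+ j.+1 = a * q / (b * c * d) * q ^+ j.
    by rewrite exprS; field; rewrite b0 c0 d0.
  by move/shifted_neq0: nbcd; apply.
have hh : f (a * q / (b * c * d)) != 0.
  by move: nbcd; rewrite shiftedSl mulf_eq0 negb_or => /andP[].
have hh' : f (b * c * d / (a * q)) != 0.
  have -> : b * c * d / (a * q) = (a * q / (b * c * d))^-1 by rewrite invf_div.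
  have nz : a * q / (b * c * d) != 0 by rewrite !mulf_neq0 ?invr_eq0.
  by rewrite (lawV L) // oppr_eq0 mulf_neq0 ?invr_eq0.
transitivity (\sum_(0 <= k < N.+2)
    (abel_up a b c d e N k - abel_down a b c d e N k)).
  apply: eq_big_nat => k /andP[_ kN].
  by apply: vwp_term_split => //;
    [exact: sub nq | exact: sub nb | exact: sub nc | exact: sub nd
    | exact: sub ne | exact: sub nN].
have up0 : abel_up a b c d e N N.+1 = 0.
  by rewrite /abel_up (shiftedSr _ (q ^- N)) mulVf // (law1 L) !(mulr0, mul0r).
rewrite sumrB big_nat_recr //= up0 addr0 [X in _ - X]big_nat_recl //= add0r.
rewrite -sumrB.
pose rho := f (a * q) * f (a * q / (b * c)) * f (a * q / (b * d)) * f (a * q / (c * d))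
  / (f (a * q / b) * f (a * q / c) * f (a * q / d) * f (a * q / (b * c * d))).
transitivity (\sum_(0 <= k < N.+1) rho * vwp_term (a * q) b c d (e * q) N k).
  apply: eq_big_nat => k /andP[_ kN].
  by apply: abel_shift => //; [apply: sub nq | exact: sub nb | exact: sub nc
    | exact: sub nd | apply: sub ne | apply: sub nN]; apply: ltnW.
rewrite -mulr_sumr.
have -> : e * q = (a * q) ^+ 2 * q ^+ N.+1 / (b * c * d).
  by rewrite /e (exprS _ N.+1); field; rewrite b0 c0 d0.
have shb (z : F) : a * q / z * q = a * q * q / z by rewrite mulrAC.
move: nb nc nd nbcd.
rewrite ![ph _ N.+1]shiftedSl !shb !mulf_eq0 !negb_or.
move=> /andP[nb1 nb] /andP[nc1 nc] /andP[nd1 nd] /andP[_ nbcd].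
rewrite IH ?mulf_neq0 //; last 2 first.
- exact: sub nq.
- by have := sub _ _ N (leqnSn N) nN; rewrite exprS mulrA.
rewrite /rho; field_nz.
Qed.

End FrenkelTuraev.

(** * Two interpolation formulas for theta functions *)

Section Interpolation.
Variables (F : fieldType) (f : F -> F).
Hypothesis L : theta_law f.

(** [f (x y) f (x / y)] behaves like [x] times an antisymmetric form of rank two
in the pair [(x, y)]; this is what makes interpolation in [x] possible. *)
Definition theta_pm (x y : F) : F := f (x * y) * f (x / y).

Lemma theta_pm_swap x y : x != 0 -> y != 0 ->
  theta_pm y x = - (y / x) * theta_pm x y.
Proof.
move=> x0 y0; rewrite /theta_pm -[y / x]invf_div (lawV L) ?mulf_neq0 ?invr_eq0 //.
by rewrite invf_div (mulrC y x); field_nz.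
Qed.

(** The Pluecker relation for [theta_pm], read off from [law3]. *)
Lemma theta_pm_exchange g y z w :
  g != 0 -> y != 0 -> z != 0 -> w != 0 ->
  theta_pm g y * theta_pm z w =
  theta_pm z y * theta_pm g w - z / w * theta_pm g z * theta_pm w y.
Proof.
move=> g0 y0 z0 w0; rewrite /theta_pm.
have n1 : z / y != 0 by rewrite mulf_neq0 ?invr_eq0.
have n2 : g / z != 0 by rewrite mulf_neq0 ?invr_eq0.
have n3 : w * y != 0 by rewrite mulf_neq0 ?invr_eq0.
have n4 : y / w != 0 by rewrite mulf_neq0 ?invr_eq0.
have := law3 L n1 n2 n3 n4.
have -> : g / z * (w * y) * (y / w) * (z / y) = g * y by field_nz.
have -> : g / z * (w * y) * (y / w) * (z / y) ^+ 2 = g * z by field_nz.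
have -> : g / z * (z / y) = g / y by field_nz.
have -> : w * y * (z / y) = z * w by field_nz.
have -> : y / w * (z / y) = z / w by field_nz.
have -> : w * y * (y / w) * (z / y) = z * y by field_nz.
have -> : g / z * (y / w) * (z / y) = g / w by field_nz.
have -> : g / z * (w * y) * (z / y) = g * w by field_nz.
have -> : f (y / w) = - (f (w / y) / (w / y)).
  by rewrite -[y / w]invf_div (lawV L) ?mulf_neq0 ?invr_eq0.
by move/(canRL (subrK _)); rewrite !mulrA => ->; field_nz.
Qed.

(** As [theta_pm x y] is, up to factors that depend on [x] or on [y] alone, a
difference [phi x - phi y], this is Lagrange interpolation at the nodes [z i] of
a polynomial of degree [size ys] in [phi g].  The induction adds a node [w] and a
zero [y] at the same time: [theta_pm_exchange] splits off the term at the old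
node and leaves a sum which is the induction hypothesis at [g = w]. *)
Lemma theta_lagrange (I : eqType) (s : seq I) (z : I -> F) (ys : seq F) (g : F) :
  uniq s -> size s = (size ys).+1 -> g != 0 ->
  {in s, forall i, z i != 0} -> {in ys, forall y, y != 0} ->
  {in s &, forall i j, i != j -> theta_pm (z i) (z j) != 0} ->
  \sum_(i <- s) ((\prod_(y <- ys) theta_pm (z i) y) *
     \prod_(j <- s | j != i) (theta_pm g (z j) / theta_pm (z i) (z j)))
  = \prod_(y <- ys) theta_pm g y.
Proof.
elim: ys s g => [|y ys IH] [|w s] g //=.
  case: s => // _ _ _ _ _ _; rewrite big_seq1 !big_nil mul1r.
  by rewrite big_cons big_nil eqxx.
move=> /andP[ws us] [ss] g0 z0 y0 nz.
have {}z0' : {in s, forall i, z i != 0} by move=> i si; apply: z0; rewrite inE si orbT.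
have w0 : z w != 0 by apply: z0; rewrite mem_head.
have yy0 : y != 0 by apply: y0; rewrite mem_head.
have y0' : {in ys, forall i, i != 0} by move=> i si; apply: y0; rewrite inE si orbT.
have nzw i : i \in s -> theta_pm (z i) (z w) != 0.
  move=> si; apply: nz; rewrite ?inE ?eqxx ?si ?orbT //.
  by apply: contraNneq ws => <-.
have nz' : {in s &, forall i j, i != j -> theta_pm (z i) (z j) != 0}.
  by move=> i j si sj; apply: nz; rewrite inE ?si ?sj orbT.
have IHg := IH s g us ss g0 z0' y0' nz'.
have IHw := IH s (z w) us ss w0 z0' y0' nz'.
have prod_split i (h : F) : i \in s ->
    \prod_(j <- w :: s | j != i) (theta_pm h (z j) / theta_pm (z i) (z j))
  = theta_pm h (z w) / theta_pm (z i) (z w) *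
    \prod_(j <- s | j != i) (theta_pm h (z j) / theta_pm (z i) (z j)).
  by move=> si; rewrite big_cons ifT //; apply: contraNneq ws => ->.
have prod_full i : i \in s ->
    \prod_(j <- s) (theta_pm g (z j) / theta_pm (z w) (z j))
  = theta_pm g (z i) / theta_pm (z w) (z i)
    * \prod_(j <- s | j != i) (theta_pm g (z j) / theta_pm (z w) (z j)).
  by move=> si; rewrite (bigD1_seq i).
rewrite big_cons !big_cons eqxx /= -IHg.
have -> : \prod_(j <- s | j != w) (theta_pm g (z j) / theta_pm (z w) (z j))
  = \prod_(j <- s) (theta_pm g (z j) / theta_pm (z w) (z j)).
  rewrite big_seq_cond [RHS]big_seq; apply: eq_bigl => j.
  by case sj: (j \in s) => //=; apply: contraNneq ws => <-; rewrite sj.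
rewrite -mulrA -IHw mulr_suml mulr_sumr mulr_sumr -big_split /= big_seq [RHS]big_seq.
apply: eq_bigr => i si.
rewrite prod_split // big_cons.
rewrite (prod_full i si).
have -> : \prod_(j <- s | j != i) (theta_pm g (z j) / theta_pm (z i) (z j))
  = \prod_(j <- s | j != i) (theta_pm g (z j) / theta_pm (z w) (z j)) *
    \prod_(j <- s | j != i) (theta_pm (z w) (z j) / theta_pm (z i) (z j)).
  rewrite -big_split /= [LHS]big_seq_cond [RHS]big_seq_cond; apply: eq_bigr => j /andP[sj ji].
  have ? : theta_pm (z i) (z j) != 0 by apply: nz'; rewrite // eq_sym.
  have ? : theta_pm (z w) (z j) != 0.
    by apply: nz; rewrite ?mem_head ?inE ?sj ?orbT //; apply: contraNneq ws => ->.
  by rewrite mulrA divfK.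
have := theta_pm_exchange g0 yy0 (z0' i si) w0.
rewrite (theta_pm_swap (z0' i si) w0).
have := nzw i si; have := z0' i si.
move: (theta_pm g y) (theta_pm (z i) (z w)) => A B ? ?.
by move/(canRL (mulfK _)) => -> //; field_nz.
Qed.

(** The elliptic partial fraction expansion for the nodes [z i] and zeros
[x i], whose products differ by the factor [q ^+ K].  The expansion holds for
arbitrary nodes, but its inductive proof divides by [f] at the quotient of the
partial products; for nodes on a [q]-grid this is [f (q ^+ m)] with
[m <= K], which is controlled, except when [m = 0], a case where only the last
node contributes. *)
Lemma theta_interpolation (I : eqType) (s : seq I) (q : F) (x : I -> F)
    (k : I -> nat) (w : F) (z := fun i => x i * q ^+ k i)
    (K := (\sum_(i <- s) k i)%N) :
  uniq s -> q != 0 -> w != 0 -> {in s, forall i, x i != 0} ->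
  {in s &, forall i j, i != j -> f (z i / z j) != 0} ->
  (forall m, (0 < m <= K)%N -> f (q ^+ m) != 0) ->
  \sum_(i <- s) (f (w * z i / q ^+ K) * (\prod_(j <- s) f (z i / x j)) *
     \prod_(j <- s | j != i) (f (w * z j) / f (z i / z j)))
  = f (q ^+ K) * \prod_(j <- s) f (w * x j).
Proof.
rewrite {}/K => + q0; elim: s w => [|v s IH] w; first by rewrite !big_nil expr0 (law1 L) mul0r.
set K := (\sum_(i <- s) k i)%N in IH *.
rewrite cons_uniq => /andP[vs us] w0 x0 nz nq.
have qn0 n : q ^+ n != 0 by rewrite expf_neq0.
have z0 i : i \in v :: s -> z i != 0 by move=> si; rewrite mulf_neq0 ?x0.
have sv i : i \in s -> i \in v :: s by rewrite inE orbC => ->.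
have vv : v \in v :: s by rewrite mem_head.
have neqv i : i \in s -> i != v by apply: contraTneq => ->.
have prod_v (h : I -> F) : \prod_(j <- s | j != v) h j = \prod_(j <- s) h j.
  rewrite big_seq_cond [RHS]big_seq; apply: eq_bigl => j.
  by case sj: (j \in s) => //=; apply: neqv.
rewrite !big_cons eqxx /= prod_v -/K.
(* [f (q ^+ K)] is about to be cancelled, hence the case distinction. *)
have [K0|Kpos] := posnP K.
  have k0 i : i \in s -> k i = 0%N.
    by move: K0 => /eqP; rewrite sum_nat_seq_eq0 => /allP h /h /eqP.
  have zx i : i \in s -> z i = x i by move=> si; rewrite /z k0 // expr0 mulr1.
  rewrite [X in _ + X]big_seq [X in _ + X]big1 ?addr0; last first.
    move=> i si; rewrite big_cons [X in f (z i / x v) * X](bigD1_seq i) //=.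
    by rewrite zx // divff ?x0 ?sv // (law1 L) !(mul0r, mulr0).
  have -> : w * z v / q ^+ (k v + K) = w * x v.
    by rewrite K0 addn0 mulrA mulfK.
  have -> : z v / x v = q ^+ (k v + K) by rewrite K0 addn0 /z mulrAC mulfV ?mul1r ?x0.
  rewrite -!mulrA -big_split /= mulrCA; congr (_ * (_ * _)).
  rewrite !big_seq; apply: eq_bigr => j sj; rewrite -zx // mulrC mulfVK //.
  by apply: nz; rewrite ?vv // ?sv // eq_sym neqv.
have {}nq m : (0 < m <= k v + K)%N -> f (q ^+ m) != 0.
  by move=> h; apply: nq; rewrite big_cons.
have fT : f (q ^+ K) != 0 by apply: nq; rewrite Kpos leq_addl.
have nz' : {in s &, forall i j, i != j -> f (z i / z j) != 0}.
  by move=> i j si sj; apply: nz; apply: sv.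
have x0' : {in s, forall i, x i != 0} by move=> i /sv; apply: x0.
have nq' m : (0 < m <= K)%N -> f (q ^+ m) != 0.
  by move=> /andP[m0 mK]; apply: nq; rewrite m0 (leq_trans mK) ?leq_addl.
have prod_zx : \prod_(j <- s) z j = q ^+ K * \prod_(j <- s) x j.
  by rewrite /z big_split /= mulrC prodrXr.
have zvE : z v = x v * q ^+ k v by [].
clearbody z.
have zv0 := z0 v vv.
have zv1 : (z v)^-1 != 0 by rewrite invr_eq0.
have nzv i : i \in s -> f (z i / z v) != 0.
  by move=> si; apply: nz; rewrite ?vv // ?sv // neqv.
have nvz i : i \in s -> f (z v / z i) != 0.
  by move=> si; apply: nz; rewrite ?vv // ?sv // eq_sym neqv.
(* The term of the new node, rewritten by the induction hypothesis at
   [w = 1 / z v] as a sum over the old nodes. *)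
have last_term : f (q ^+ K) * \prod_(j <- s) (f (z v / x j) / f (z v / z j))
   = q ^+ K * \sum_(i <- s) (f (z i / z v / q ^+ K) / f (z i / z v)
       * (\prod_(j <- s) f (z i / x j)) * \prod_(j <- s | j != i) (f (z i / z j))^-1).
  have -> : \prod_(j <- s) (f (z v / x j) / f (z v / z j)) =
     q ^+ K * ((\prod_(j <- s) f ((z v)^-1 * x j)) / \prod_(j <- s) f (z j / z v)).
    have -> : q ^+ K = (\prod_(j <- s) z j) / \prod_(j <- s) x j.
      by rewrite prod_zx mulfK // prodf_seq_neq0; apply/allP => j /x0'.
    rewrite -!prodf_div -big_split /= !big_seq; apply: eq_bigr => j sj.
    have ? := nzv _ sj; have ? := x0' _ sj; have ? := z0 _ (sv _ sj).
    rewrite -[z v / x j]invf_div -[z v / z j]invf_div !(lawV L) ?mulf_neq0 ?invr_eq0 //.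
    by rewrite (mulrC (z v)^-1); field_nz.
  rewrite mulrCA; congr (_ * _); rewrite mulrA -(IH (z v)^-1) //.
  rewrite mulr_suml [LHS]big_seq [RHS]big_seq; apply: eq_bigr => i si.
  rewrite [\prod_(j <- s) f (z j / z v)](bigD1_seq i) //= big_split /= -(mulrC (z i)).
  have -> : \prod_(j <- s | j != i) f ((z v)^-1 * z j) = \prod_(j <- s | j != i) f (z j / z v).
    by apply: eq_bigr => j _; rewrite mulrC.
  have : \prod_(j <- s | j != i) f (z j / z v) != 0.
    by rewrite prodf_seq_neq0; apply/allP => j sj; apply/implyP => _; apply: nzv.
  by have := nzv i si => *; field_nz.
have {}IH := IH w us w0 x0' nz' nq'.
apply: (mulfI fT).
rewrite mulrDr.
have -> : f (q ^+ K) * (f (w * z v / q ^+ (k v + K)) *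
    (f (z v / x v) * \prod_(j <- s) f (z v / x j)) *
    \prod_(j <- s) (f (w * z j) / f (z v / z j))) =
  f (w * z v / q ^+ (k v + K)) * f (z v / x v) * (\prod_(j <- s) f (w * z j)) *
  (f (q ^+ K) * \prod_(j <- s) (f (z v / x j) / f (z v / z j))).
  by rewrite !prodf_div; ring.
have -> : f (q ^+ K) * (f (q ^+ (k v + K)) * (f (w * x v) * \prod_(j <- s) f (w * x j)))
  = f (q ^+ (k v + K)) * f (w * x v) * (f (q ^+ K) * \prod_(j <- s) f (w * x j)).
  by ring.
rewrite last_term -IH !mulr_sumr -big_split /= [LHS]big_seq [RHS]big_seq.
apply: eq_bigr => i si.
have xv0 := x0 v vv; have zi0 := z0 i (sv i si).
have n1 : z v / x v != 0 by rewrite mulf_neq0 ?invr_eq0.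
have n2 : w * z v / q ^+ (k v + K) != 0 by rewrite !mulf_neq0 ?invr_eq0.
have n3 : z i / z v / q ^+ K != 0 by rewrite !mulf_neq0 ?invr_eq0.
have := law3 L (qn0 K) n1 n2 n3.
have qk0 := qn0 (k v); have qK0 := qn0 K.
have -> : z v / x v * (w * z v / q ^+ (k v + K)) * (z i / z v / q ^+ K) * q ^+ K
  = w * z i / q ^+ K by rewrite exprD zvE; field_nz.
have -> : z v / x v * q ^+ K = q ^+ (k v + K) by rewrite exprD zvE; field_nz.
have -> : w * z v / q ^+ (k v + K) * q ^+ K = w * x v by rewrite exprD zvE; field_nz.
have -> : z i / z v / q ^+ K * q ^+ K = z i / z v by field_nz.
have -> : w * z v / q ^+ (k v + K) * (z i / z v / q ^+ K) * q ^+ K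
  = w * z i / q ^+ (k v + K) by rewrite exprD; field_nz.
have -> : z v / x v * (z i / z v / q ^+ K) * q ^+ K = z i / x v by field_nz.
have -> : z v / x v * (w * z v / q ^+ (k v + K)) * q ^+ K = w * z v
  by rewrite exprD zvE; field_nz.
have -> : z v / x v * (w * z v / q ^+ (k v + K)) * (z i / z v / q ^+ K) * q ^+ K ^+ 2
  = w * z i by rewrite exprD zvE; field_nz.
rewrite !big_cons ifT 1?eq_sym ?neqv // [\prod_(j <- s) f (w * z j)](bigD1_seq i) //=.
rewrite !prodf_div prodfV; set D := \prod_(j <- s | j != i) f (z i / z j).
have ? : D != 0.
  rewrite prodf_seq_neq0; apply/allP => j sj; apply/implyP => ji.
  by apply: nz'; rewrite // eq_sym.
move/(canRL (subrK _)) => E; have ? := nzv i si.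
pose M := (\prod_(j <- s) f (z i / x j)) * (\prod_(j <- s | j != i) f (w * z j))
  / (D * f (z i / z v)).
transitivity (M * (f (w * z i / q ^+ K) * f (q ^+ (k v + K)) * f (w * x v) *
   f (z i / z v))); last by rewrite /M; field_nz.
by rewrite E /M; field_nz.
Qed.
End Interpolation.

(** * The sum over all tuples of a fixed weight *)

(** Changing the data at one index [r] changes only the pairs that contain [r]. *)
Lemma prod_pairs_update (F : comNzRingType) n (G H : 'I_n -> 'I_n -> F) (c d : 'I_n -> F)
    (r : 'I_n) :
  (forall i j : 'I_n, (i < j)%N -> i != r -> j != r -> G i j = H i j) ->
  (forall j : 'I_n, (r < j)%N -> G r j = H r j * c j) ->
  (forall i : 'I_n, (i < r)%N -> G i r = H i r * d i) ->
  \prod_(i < n) \prod_(j < n | (i < j)%N) G i j =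
  (\prod_(i < n) \prod_(j < n | (i < j)%N) H i j)
  * (\prod_(j < n | (r < j)%N) c j) * \prod_(i < n | (i < r)%N) d i.
Proof.
move=> GH Gc Gd.
have -> : \prod_(j < n | (r < j)%N) c j
    = \prod_(i < n) \prod_(j < n | (i < j)%N) (if i == r then c j else 1).
  rewrite [RHS](bigD1 r) //= eqxx [X in _ * X]big1 ?mulr1 // => i /negbTE->.
  by rewrite big1.
have -> : \prod_(i < n | (i < r)%N) d i
    = \prod_(i < n) \prod_(j < n | (i < j)%N) (if j == r then d i else 1).
  rewrite big_mkcond; apply: eq_bigr => i _; rewrite -big_mkcondr.
  case: ltnP => ir.
    rewrite (big_pred1 r) // => j /=.
    by case: (eqVneq j r) => [->|]; rewrite ?ir ?andbF.
  rewrite big_pred0 // => j /=.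
  by case: (eqVneq j r) => [->|]; rewrite ?andbF // ltnNge ir.
rewrite -!big_split; apply: eq_bigr => i _; rewrite -!big_split.
apply: eq_bigr => j ij /=; case: (eqVneq i r) => [ir|ir].
  have /negbTE-> : j != r by rewrite -ir; apply: contraTneq ij => ->; rewrite ltnn.
  by rewrite mulr1 ir Gc // -ir.
case: (eqVneq j r) => [jr|jr]; first by rewrite mulr1 jr Gd // -jr.
by rewrite !mulr1 GH.
Qed.

Section InnerSum.
Variables (F : fieldType) (f : F -> F) (q : F).
Hypotheses (L : theta_law f) (q_neq0 : q != 0).
Variables (n N : nat) (x : 'I_n -> F) (y : 'I_n.-1 -> F) (g : F).
Hypotheses (n_gt0 : (0 < n)%N) (g_neq0 : g != 0) (x_neq0 : forall r, x r != 0)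
  (y_neq0 : forall s, y s != 0).

Local Notation ph a k := (shifted f a q k).

(** In the parts of the summand below, [m] stands for the sum of the entries of
[k]; it is a separate argument so that tuples of consecutive weights can be
compared part by part. *)
Definition pair_part (k : 'I_n -> nat) : F :=
  \prod_(r < n) \prod_(s < n | (r < s)%N)
    (f (q ^ ((k r)%:Z - (k s)%:Z) * x r / x s)
     / (f (x r / x s) * ph (x r * x s) (k r + k s))).

Definition y_part (k : 'I_n -> nat) (m : nat) : F :=
  \prod_(s < n.-1)
    ((\prod_(r < n) (ph (x r * y s) (k r) * ph (x r / y s) (k r)))
     / (ph (g * y s) m * ph (g / y s) m)).

Definition g_part (k : 'I_n -> nat) (m : nat) : F :=
  \prod_(r < n)
    (ph (g * x r) m * ph (g / x r) (m - k r)
     / (ph (g * x r) (k r) * \prod_(s < n) ph (q * x r / x s) (k r))).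

Definition inner_term (k : 'I_n -> nat) (m : nat) : F :=
  pair_part k * y_part k m * g_part k m * q ^+ (\sum_(r < n) r * k r) * ph q m.

Hypotheses
  (pair_neq0 : forall (i j : 'I_n) a b, i != j -> (a <= N)%N -> (b <= N)%N ->
     f (x i * q ^+ a / (x j * q ^+ b)) != 0)
  (prod_neq0 : forall (i j : 'I_n) m, i != j -> (m < N)%N ->
     f (x i * x j * q ^+ m) != 0)
  (gy_neq0 : forall s m, (m < N)%N ->
     f (g * y s * q ^+ m) != 0 /\ f (g / y s * q ^+ m) != 0)
  (gx_neq0 : forall r m, (m < N)%N -> f (g * x r * q ^+ m) != 0)
  (qx_neq0 : forall r s m, (m < N)%N -> f (q * x r / x s * q ^+ m) != 0).

Let node (k : 'I_n -> nat) (i : 'I_n) : F := x i * q ^+ k i.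

Let qn0 m : q ^+ m != 0. Proof. by rewrite expf_neq0. Qed.

Let node_neq0 k i : node k i != 0. Proof. by rewrite mulf_neq0. Qed.

Lemma node_ratio k (i j : 'I_n) :
  q ^ ((k i)%:Z - (k j)%:Z) * x i / x j = node k i / node k j.
Proof.
have xj := x_neq0 j; rewrite /node expfzDr // -invr_expz -!exprnP.
by field; rewrite xj qn0.
Qed.

Section Step.
Variables (k : 'I_n -> nat) (r : 'I_n) (m : nat).
Hypotheses (sum_k : (\sum_(i < n) k i)%N = m) (mN : (m < N)%N).

Let k' (s : 'I_n) : nat := (k s + (s == r))%N.

Let le_km i : (k i <= m)%N. Proof. by rewrite -sum_k (bigD1 i) //= leq_addr. Qed.
Let le_kkm i j : i != j -> (k i + k j <= m)%N.
Proof.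
move=> ij; rewrite -sum_k (bigD1 i) //= leq_add2l (bigD1 j) /= ?leq_addr //.
by rewrite eq_sym.
Qed.

Let k'r : k' r = (k r).+1. Proof. by rewrite /k' eqxx addn1. Qed.
Let k'j j : j != r -> k' j = k j. Proof. by move/negbTE=> h; rewrite /k' h addn0. Qed.

(** The power of [q] compensates the orientation of the pairs: inverting the
argument of [f] in the pairs [(i, r)] with [i < r] costs a factor [1/q] each,
and these are [r] pairs. *)
Lemma pair_part_step :
  pair_part k' * q ^+ (\sum_(s < n) s * k' s) =
  pair_part k * q ^+ (\sum_(s < n) s * k s) *
  \prod_(j < n | j != r)
     (f (q * node k r / node k j) / (f (node k r / node k j) * f (node k r * node k j))).
Proof.
(* The factor by which the pair of [r] and [j] changes when [r] comes first. *)
pose R j := f (q * node k r / node k j) / (f (node k r / node k j) * f (node k r * node k j)).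
have nz i j : i != j -> f (node k i / node k j) != 0.
  by move=> ij; apply: pair_neq0 => //; apply: leq_trans (le_km _) (ltnW mN).
have pz i j : i != j -> f (node k i * node k j) != 0.
  move=> ij; rewrite /node mulrACA -exprD; apply: prod_neq0 => //.
  exact: leq_ltn_trans (le_kkm ij) mN.
have node_r : node k' r = q * node k r.
  by rewrite /node k'r exprS; ring.
have node_j j : j != r -> node k' j = node k j by move=> jr; rewrite /node k'j.
have shiftE i j : x i * x j * q ^+ (k i + k j) = node k i * node k j.
  by rewrite /node exprD mulrACA.
have xz i j : i != j -> f (x i / x j) != 0.
  by move=> ij; have := pair_neq0 ij (leq0n N) (leq0n N); rewrite expr0 !mulr1.
have sz i j : i != j -> ph (x i * x j) (k i + k j) != 0.
  move=> ij; apply/shifted_neq0 => a ak; apply: prod_neq0 => //.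
  by apply: leq_trans (leq_trans ak (le_kkm ij)) (ltnW mN).
have -> : (\sum_(s < n) s * k' s = \sum_(s < n) s * k s + r)%N.
  rewrite (bigD1 r) //= k'r mulnS [in RHS](bigD1 r) //= -!addnA addnC -!addnA.
  congr (_ + _)%N; congr (_ + _)%N; apply: eq_bigr => s sr; rewrite k'j //.
rewrite exprD /pair_part.
rewrite (@prod_pairs_update _ _ _
  (fun i j : 'I_n => f (q ^ ((k i)%:Z - (k j)%:Z) * x i / x j)
     / (f (x i / x j) * ph (x i * x j) (k i + k j))) R (fun i => R i / q) r); first last.
- move=> i ir; have ine : i != r by apply: contraTneq ir => ->; rewrite ltnn.
  have rne : r != i by rewrite eq_sym.
  rewrite !node_ratio node_r node_j // k'r k'j // addnS shiftedSr shiftE /R.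
  have := nz _ _ rne; have := pz _ _ rne; have := xz _ _ ine; have := sz _ _ ine.
  have ni0 := node_neq0 k i; have nr0 := node_neq0 k r.
  rewrite (mulrC (node k i) (node k r)).
  have -> : node k i / (q * node k r) = (q * node k r / node k i)^-1 by rewrite invf_div.
  have -> : node k i / node k r = (node k r / node k i)^-1 by rewrite invf_div.
  rewrite !(lawV L) ?mulf_neq0 ?invr_eq0 // => *.
  by field_nz.
- move=> j rj; have jne : j != r by apply: contraTneq rj => ->; rewrite ltnn.
  have rne : r != j by rewrite eq_sym.
  rewrite !node_ratio node_r node_j // k'r k'j // addSn shiftedSr shiftE /R.
  have := nz _ _ rne; have := pz _ _ rne; have := xz _ _ rne; have := sz _ _ rne.
  have ni0 := node_neq0 k j; have nr0 := node_neq0 k r.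
  by move=> *; field_nz.
- by move=> i j _ ir jr; rewrite !k'j.
have -> : q ^+ r = \prod_(i < n | (i < r)%N) q.
  by rewrite -(big_ord_widen _ (fun=> q)) ?prodr_const ?card_ord // ltnW.
have -> : \prod_(j < n | j != r) R j =
   (\prod_(j < n | (r < j)%N) R j) * \prod_(i < n | (i < r)%N) R i.
  rewrite (bigID (fun j : 'I_n => (r < j)%N)) /=; congr (_ * _); apply: eq_bigl => j.
    by rewrite andbC; case: ltnP => //= rj; apply: contraTneq rj => ->; rewrite ltnn.
  by rewrite -leqNgt -ltn_neqAle.
rewrite [\prod_(i < n | (i < r)%N) (R i / q)]big_split /= prodfV.
have : \prod_(i < n | (i < r)%N) q != 0.
  by rewrite prodf_seq_neq0; apply/allP => i _; rewrite q_neq0 implybT.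
move: (\prod_(j < n | (r < j)%N) R j) => ? ?; field_nz.
Qed.

Lemma y_part_step :
  y_part k' m.+1 =
  y_part k m * \prod_(s < n.-1) (theta_pm f (node k r) (y s) / theta_pm f (g * q ^+ m) (y s)).
Proof.
rewrite /y_part -big_split /=; apply: eq_bigr => s _.
rewrite (bigD1 r) //= [in RHS](bigD1 r) //= k'r !shiftedSr.
have -> : \prod_(i < n | i != r) (ph (x i * y s) (k' i) * ph (x i / y s) (k' i))
  = \prod_(i < n | i != r) (ph (x i * y s) (k i) * ph (x i / y s) (k i)).
  by apply: eq_bigr => i ir; rewrite k'j.
rewrite /theta_pm.
have -> : node k r * y s = x r * y s * q ^+ k r by rewrite /node mulrAC.
have -> : node k r / y s = x r / y s * q ^+ k r by rewrite /node mulrAC.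
have -> : g * q ^+ m * y s = g * y s * q ^+ m by rewrite mulrAC.
have -> : g * q ^+ m / y s = g / y s * q ^+ m by rewrite mulrAC.
have [h1 h2] := gy_neq0 s mN.
have h3 : ph (g * y s) m != 0.
  by apply/shifted_neq0 => j jm; have [] := gy_neq0 s (ltn_trans jm mN).
have h4 : ph (g / y s) m != 0.
  by apply/shifted_neq0 => j jm; have [] := gy_neq0 s (ltn_trans jm mN).
field_nz.
Qed.

Lemma g_part_step :
  g_part k' m.+1 * (f (g * node k r) * \prod_(s < n) f (q * node k r / x s)) =
  g_part k m * \prod_(s < n) f (g * x s * q ^+ m)
  * \prod_(j < n | j != r) f (g * q ^+ m / node k j).
Proof.
rewrite /g_part [in LHS](bigD1 r) //= [in X in _ = X * _ * _](bigD1 r) //=.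
rewrite [\prod_(s < n) f (g * x s * q ^+ m)](bigD1 r) //=.
have -> : \prod_(i < n | i != r) (ph (g * x i) m.+1 * ph (g / x i) (m.+1 - k' i)
     / (ph (g * x i) (k' i) * \prod_(s < n) ph (q * x i / x s) (k' i)))
  = (\prod_(i < n | i != r) (ph (g * x i) m * ph (g / x i) (m - k i)
     / (ph (g * x i) (k i) * \prod_(s < n) ph (q * x i / x s) (k i))))
   * (\prod_(i < n | i != r) f (g * x i * q ^+ m))
   * \prod_(i < n | i != r) f (g * q ^+ m / node k i).
  rewrite -!big_split; apply: eq_bigr => i ir /=.
  rewrite k'j // subSn // !shiftedSr.
  have -> : g / x i * q ^+ (m - k i) = g * q ^+ m / node k i.
    rewrite -{2}(subnK (le_km i)) exprD /node; have := x_neq0 i; have := qn0 (k i).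
    by move=> *; field_nz.
  by ring.
rewrite k'r subSS !shiftedSr.
have -> : \prod_(s < n) ph (q * x r / x s) (k r).+1 =
  (\prod_(s < n) ph (q * x r / x s) (k r)) * \prod_(s < n) f (q * node k r / x s).
  rewrite -big_split; apply: eq_bigr => s _; rewrite shiftedSr /node.
  by congr (_ * f _); rewrite mulrA mulrAC.
have -> : g * x r * q ^+ k r = g * node k r by rewrite mulrA.
have h0 : (k r < N)%N by apply: leq_ltn_trans (le_km r) mN.
have h1 : f (g * node k r) != 0 by rewrite /node mulrA; apply: gx_neq0.
have h2 : \prod_(s < n) f (q * node k r / x s) != 0.
  rewrite prodf_seq_neq0; apply/allP => s _ /=.
  by have := qx_neq0 r s h0; rewrite /node mulrA mulrAC.
have h3 : ph (g * x r) (k r) != 0.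
  by apply/shifted_neq0 => j jm; apply: gx_neq0; apply: ltn_trans jm h0.
have h4 : \prod_(s < n) ph (q * x r / x s) (k r) != 0.
  rewrite prodf_seq_neq0; apply/allP => s _ /=.
  by apply/shifted_neq0 => j jm; apply: qx_neq0; apply: ltn_trans jm h0.
field_nz.
Qed.

(** The unnormalized weight of reaching [h] by increasing its entry [r]: the
summand at [r] in [theta_interpolation] for the nodes [node h]. *)
Definition arrival (h : 'I_n -> nat) : F :=
  f (g * q ^+ m * node h r / q ^+ m.+1) * (\prod_(j < n) f (node h r / x j))
  * (\prod_(j < n | j != r) (f (g * q ^+ m * node h j) / f (node h r / node h j))).

(** The unnormalized weight of leaving [k] by increasing its entry [r]: the
summand at [r] in [theta_lagrange] for the nodes [node k]. *)
Definition departure : F :=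
  (\prod_(s < n.-1) theta_pm f (node k r) (y s)) *
  \prod_(j < n | j != r) (theta_pm f (g * q ^+ m) (node k j) / theta_pm f (node k r) (node k j)).

(** Detailed balance between [k] and the tuple with entry [r] increased by one. *)
Lemma inner_term_step :
  inner_term k' m.+1 * arrival k' / (f (q ^+ m.+1) * \prod_(j < n) f (g * q ^+ m * x j))
  = inner_term k m * departure / \prod_(s < n.-1) theta_pm f (g * q ^+ m) (y s).
Proof.
have node_r : node k' r = q * node k r.
  by rewrite /node k'r exprS; ring.
have node_j j : j != r -> node k' j = node k j by move=> jr; rewrite /node k'j.
rewrite /arrival node_r.
have -> : g * q ^+ m * (q * node k r) / q ^+ m.+1 = g * node k r.
  by rewrite exprS; have := qn0 m => ?; field_nz.
have -> : \prod_(j < n | j != r) (f (g * q ^+ m * node k' j) / f (q * node k r / node k' j))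
  = (\prod_(j < n | j != r) f (g * q ^+ m * node k j))
    / \prod_(j < n | j != r) f (q * node k r / node k j).
  by rewrite -prodf_div; apply: eq_bigr => j jr; rewrite node_j.
have -> : \prod_(j < n) f (g * q ^+ m * x j) = \prod_(j < n) f (g * x j * q ^+ m).
  by apply: eq_bigr => j _; rewrite mulrAC.
have := pair_part_step; have := y_part_step; have := g_part_step.
rewrite /departure /inner_term /theta_pm !prodf_div !big_split /= (shiftedSr f q q) -exprS.
set a := f (g * node k r); set B := \prod_(s < n) f (q * node k r / x s).
set C := \prod_(j < n) f (g * x j * q ^+ m).
set N1 := \prod_(j < n | j != r) f (q * node k r / node k j).
set D1 := \prod_(i < n | i != r) f (node k r / node k i).
set D2 := \prod_(i < n | i != r) f (node k r * node k i).
set fq := f (q ^+ m.+1).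
set Y1 := \prod_(i < n.-1) f (g * q ^+ m * y i).
set Y2 := \prod_(i < n.-1) f (g * q ^+ m / y i).
move=> gE yE pE.
have C0 : C != 0.
  by rewrite prodf_seq_neq0; apply/allP => j _; apply: gx_neq0.
have fq0 : fq != 0.
  by have := qx_neq0 r r mN; rewrite mulfK // -exprS.
have nz i j : i != j -> f (node k i / node k j) != 0.
  by move=> ij; apply: pair_neq0 => //; apply: leq_trans (le_km _) (ltnW mN).
have pz i j : i != j -> f (node k i * node k j) != 0.
  move=> ij; rewrite /node mulrACA -exprD; apply: prod_neq0 => //.
  exact: leq_ltn_trans (le_kkm ij) mN.
have N10 : N1 != 0.
  rewrite prodf_seq_neq0; apply/allP => j _; apply/implyP => jr.
  rewrite -node_r -(node_j j) //; apply: pair_neq0; first by rewrite eq_sym.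
    by rewrite k'r; apply: leq_ltn_trans (le_km r) mN.
  by rewrite k'j //; apply: leq_trans (le_km j) (ltnW mN).
have D10 : D1 != 0.
  rewrite prodf_seq_neq0; apply/allP => j _; apply/implyP => jr.
  by apply: nz; rewrite eq_sym.
have D20 : D2 != 0.
  rewrite prodf_seq_neq0; apply/allP => j _; apply/implyP => jr.
  by apply: pz; rewrite eq_sym.
have Y10 : Y1 != 0.
  rewrite prodf_seq_neq0; apply/allP => s _ /=.
  by have [] := gy_neq0 s mN; rewrite (mulrAC g (y s)).
have Y20 : Y2 != 0.
  rewrite prodf_seq_neq0; apply/allP => s _ /=.
  by have [_] := gy_neq0 s mN; rewrite (mulrAC g (y s)^-1).
move: gE yE pE.
move: (pair_part _) (y_part _ m.+1) (g_part _ m.+1) (q ^+ (\sum_(s < n) _)) => pp' yy' gg' qq'.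
move=> gE yE pE.
transitivity ((pp' * qq') * yy' * (gg' * (a * B)) * ph q m * fq
  * ((\prod_(j < n | j != r) f (g * q ^+ m * node k j)) / N1) / (fq * C)).
  by field_nz.
by rewrite pE yE gE; field_nz.
Qed.

End Step.

Lemma arrival_sum (h : 'I_n -> nat) m : (\sum_(i < n) h i)%N = m.+1 -> (m < N)%N ->
  \sum_(r < n) arrival r m h = f (q ^+ m.+1) * \prod_(j < n) f (g * q ^+ m * x j).
Proof.
move=> sum_h mN; have le_h i : (h i <= N)%N.
  by apply: leq_trans mN; rewrite -sum_h (bigD1 i) //= leq_addr.
have gq0 : g * q ^+ m != 0 by rewrite mulf_neq0.
have := @theta_interpolation F f L _ (index_enum 'I_n) q x h (g * q ^+ m).
rewrite sum_h; apply=> //.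
- exact: index_enum_uniq.
- by move=> i j _ _ ij; apply: pair_neq0.
- move=> [//|i] /andP[_ im]; pose r0 := Ordinal n_gt0.
  have := qx_neq0 r0 r0 (leq_trans im mN).
  by rewrite mulfK // -exprS.
Qed.

(** A tuple with [h r = 0] has no predecessor in the direction [r], and the
corresponding summand vanishes because [node h r = x r] is a zero. *)
Lemma arrival_eq0 (h : 'I_n -> nat) r m : h r = 0%N -> arrival r m h = 0.
Proof.
move=> hr; rewrite /arrival (bigD1 r) //= /node hr expr0 mulr1 divff // (law1 L).
by rewrite mul0r mulr0 mul0r.
Qed.

Lemma departure_sum (k : 'I_n -> nat) m : (\sum_(i < n) k i)%N = m -> (m < N)%N ->
  \sum_(r < n) departure k r m = \prod_(s < n.-1) theta_pm f (g * q ^+ m) (y s).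
Proof.
move=> sum_k mN; pose ys := [seq y s | s <- index_enum 'I_n.-1].
have gq0 : g * q ^+ m != 0 by rewrite mulf_neq0.
have sizeI N' : size (index_enum 'I_N') = N' by rewrite -sum1_size sum1_card card_ord.
have := @theta_lagrange F f L _ (index_enum 'I_n) (node k) ys (g * q ^+ m).
rewrite size_map !sizeI prednK // => H.
have le_k i' : (k i' <= N)%N.
  by apply: leq_trans (ltnW mN); rewrite -sum_k (bigD1 i') //= leq_addr.
rewrite [RHS](_ : _ = \prod_(t <- ys) theta_pm f (g * q ^+ m) t); last by rewrite big_map.
rewrite -{}H ?index_enum_uniq //.
- by apply: eq_bigr => i _; rewrite big_map.
- by move=> _ /mapP[s _ ->].
move=> i j _ _ ij; rewrite /theta_pm mulf_neq0 //; last exact: pair_neq0.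
rewrite /node mulrACA -exprD; apply: prod_neq0 => //.
apply: leq_ltn_trans mN; rewrite -sum_k (bigD1 i) //= leq_add2l (bigD1 j) /= ?leq_addr //.
by rewrite eq_sym.
Qed.

Let tuple_sum (k : {ffun 'I_n -> 'I_N.+1}) : nat := \sum_(r < n) k r.

(** The bound [m < N] keeps the increased entry inside ['I_N.+1]. *)
Lemma sum_over_successors (r : 'I_n) m (G : ('I_n -> nat) -> F) : (m < N)%N ->
  (forall h h', h =1 h' -> G h = G h') ->
  \sum_(k : {ffun 'I_n -> 'I_N.+1} | (tuple_sum k == m.+1) && (0 < k r)%N) G (fun i => k i) =
  \sum_(k : {ffun 'I_n -> 'I_N.+1} | tuple_sum k == m) G (fun i => k i + (i == r))%N.
Proof.
move=> mN Gext.
pose up (k : {ffun 'I_n -> 'I_N.+1}) : {ffun 'I_n -> 'I_N.+1} := [ffun i => inord (k i + (i == r))].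
pose down (k : {ffun 'I_n -> 'I_N.+1}) : {ffun 'I_n -> 'I_N.+1} := [ffun i => inord (k i - (i == r))].
rewrite (reindex_onto up down); last first.
  move=> k /andP[_ kr]; apply/ffunP => i; rewrite !ffunE; apply: val_inj => /=.
  have ki := ltn_ord (k i).
  rewrite [nat_of_ord (inord (k i - _))]inordK; last by lia.
  have e : (k i - (i == r) + (i == r) = k i)%N.
    by case: eqP => [->|_]; rewrite ?subn0 ?addn0 // subnK.
  by rewrite e inordK.
have upE (k : {ffun 'I_n -> 'I_N.+1}) i : (k r < N)%N -> up k i = (k i + (i == r))%N :> nat.
  by move=> kr; rewrite ffunE inordK //; case: eqP => [->|_]; rewrite ?addn0 ?addn1.
have sumD (k : {ffun 'I_n -> 'I_N.+1}) : (\sum_(i < n) (k i + (i == r)) = (tuple_sum k).+1)%N.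
  rewrite big_split /= -/(tuple_sum k) (bigD1 r) //= eqxx big1 ?addn0 ?addn1 //.
  by move=> i /negbTE->.
apply: eq_big => [k|k]; last first.
  case/andP=> /andP[_ kr] _; apply: Gext => i; apply: upE.
  rewrite ltn_neqAle -ltnS ltn_ord andbT; apply: contraTneq kr => kN.
  by rewrite ffunE eqxx kN addn1 /inord /insubd insubF // ltnn.
have [krN|] := boolP (k r < N)%N.
  have -> : tuple_sum (up k) = (tuple_sum k).+1.
    by rewrite -sumD; apply: eq_bigr => i _; rewrite upE.
  rewrite eqSS upE // eqxx addn1 andbT.
  have -> : down (up k) == k.
    apply/eqP/ffunP => i; apply: val_inj; rewrite ffunE /= upE // addnK.
    by rewrite inordK.
  by rewrite andbT.
rewrite -leqNgt => Nk.
have -> : (tuple_sum k == m) = false.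
  apply/negbTE; apply: contraTneq mN => <-; rewrite -leqNgt; apply: leq_trans Nk _.
  by rewrite /tuple_sum (bigD1 r) //= leq_addr.
have kN : nat_of_ord (k r) = N by apply/eqP; rewrite eqn_leq Nk -ltnS ltn_ord.
by rewrite [up k r]ffunE eqxx kN addn1 /inord /insubd insubF /= ?andbF // ltnn.
Qed.

Lemma inner_term_ext (h h' : 'I_n -> nat) m : h =1 h' -> inner_term h m = inner_term h' m.
Proof.
move=> hh; rewrite /inner_term /pair_part /y_part /g_part.
do ?congr (_ * _).
- by apply: eq_bigr => i _; apply: eq_bigr => j _; rewrite !hh.
- by apply: eq_bigr => s _; congr (_ / _); apply: eq_bigr => i _; rewrite !hh.
- apply: eq_bigr => i _; rewrite !hh; congr (_ / (_ * _)).
- by congr (_ ^+ _); apply: eq_bigr => i _; rewrite hh.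
Qed.

Lemma arrival_ext (h h' : 'I_n -> nat) r m : h =1 h' -> arrival r m h = arrival r m h'.
Proof.
by move=> hh; rewrite /arrival /node hh; congr (_ * _); apply: eq_bigr => i _; rewrite hh.
Qed.

(** By detailed balance the sum over [|k| = m + 1], weighted by [arrival], is the
sum over [|k| = m], weighted by [departure]; both weights add up to
constants. *)
Theorem inner_sum m : (m <= N)%N ->
  \sum_(k : {ffun 'I_n -> 'I_N.+1} | tuple_sum k == m) inner_term (fun r => k r) m = 1.
Proof.
elim: m => [|m IH] mN.
  rewrite (big_pred1 [ffun=> ord0]) => [|k]; last first.
    apply/idP/eqP => [/eqP s0|->]; last by rewrite /tuple_sum big1 // => i _; rewrite ffunE.
    apply/ffunP => i; apply: val_inj; rewrite ffunE /=; apply/eqP; rewrite -leqn0.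
    by rewrite -s0 /tuple_sum (bigD1 i) //= leq_addr.
  rewrite /inner_term /pair_part /y_part /g_part shifted0 mulr1.
  rewrite !big1 ?expr0 ?mulr1 //.
  - by move=> i _; rewrite ffunE muln0.
  - by move=> i _; rewrite ffunE sub0n !shifted0 mul1r big1 ?mulr1 ?divr1 // => s _; rewrite shifted0.
  - by move=> s _; rewrite !shifted0 mulr1 divr1 big1 // => i _; rewrite ffunE !shifted0 mulr1.
  - move=> i _; rewrite big1 // => j ij; rewrite !ffunE subrr mul1r shifted0 mulr1 divff //.
    have ine : i != j by apply: contraTneq ij => ->; rewrite ltnn.
    by have := pair_neq0 ine (leq0n N) (leq0n N); rewrite expr0 !mulr1.
rewrite -(IH (ltnW mN)).
pose Z := f (q ^+ m.+1) * \prod_(j < n) f (g * q ^+ m * x j).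
pose Y := \prod_(s < n.-1) theta_pm f (g * q ^+ m) (y s).
have Z0 : Z != 0.
  rewrite /Z mulf_neq0 //.
    by have := qx_neq0 (Ordinal n_gt0) (Ordinal n_gt0) mN; rewrite mulfK // -exprS.
  rewrite prodf_seq_neq0; apply/allP => j _ /=.
  by have := gx_neq0 j mN; rewrite mulrAC.
have Y0 : Y != 0.
  rewrite prodf_seq_neq0; apply/allP => s _ /=; rewrite /theta_pm.
  have [h1 h2] := gy_neq0 s mN.
  by rewrite mulf_neq0 // mulrAC.
transitivity (\sum_(k : {ffun 'I_n -> 'I_N.+1} | tuple_sum k == m.+1)
    \sum_(r < n | (0 < k r)%N) inner_term (fun i => k i) m.+1 * arrival r m (fun i => k i) / Z).
  apply: eq_bigr => k /eqP sk.
  rewrite -mulr_suml -mulr_sumr -[LHS](mulfK Z0); congr (_ * _ / _).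
  rewrite /Z -(arrival_sum sk mN) [RHS]big_mkcond; apply: eq_bigr => r _.
  by case: posnP => // kr0; rewrite (@arrival_eq0 (fun i => k i)).
transitivity (\sum_(r < n) \sum_(k : {ffun 'I_n -> 'I_N.+1} | tuple_sum k == m)
    inner_term (fun i => k i) m * departure (fun i => k i) r m / Y).
  rewrite (exchange_big_dep xpredT) //=; apply: eq_bigr => r _.
  rewrite (@sum_over_successors r m
     (fun h => inner_term h m.+1 * arrival r m h / Z)) //; last first.
    by move=> h h' hh; rewrite (inner_term_ext _ hh) (arrival_ext _ _ hh).
  by apply: eq_bigr => k /eqP sk; apply: inner_term_step.
rewrite exchange_big /=; apply: eq_bigr => k /eqP sk.
by rewrite -mulr_suml -mulr_sumr (departure_sum sk mN) mulfK.
Qed.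

End InnerSum.

(** * The multiple summation for theta laws *)

Definition shifteds (F : fieldType) (f : F -> F) (s : seq F) (q : F) (k : nat) : F :=
  \prod_(a <- s) shifted f a q k.

Lemma shifteds_neq0 (F : fieldType) (f : F -> F) s q k : shifteds f s q k != 0 ->
  {in s, forall a, shifted f a q k != 0}.
Proof. by rewrite /shifteds prodf_seq_neq0 => /allP h a /h. Qed.

(** The multiple summation for two functions that obey theta laws and have
nothing else to do with each other; the products over tuples of weight [m] are
summed first. *)
Theorem bibasic_sum (F : fieldType) (f ft : F -> F) (L : theta_law f) (Lt : theta_law ft)
  (n N : nat) (q qt a b c d g : F) (x : 'I_n -> F) (y : 'I_n.-1 -> F)
  (n_ge1 : (1 <= n)%N) (q_neq0 : q != 0) (qt_neq0 : qt != 0)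
  (a_neq0 : a != 0) (b_neq0 : b != 0) (c_neq0 : c != 0) (d_neq0 : d != 0)
  (g_neq0 : g != 0)
  (x_neq0 : forall r, x r != 0) (y_neq0 : forall s, y s != 0)
  (den_xx : forall r s : 'I_n, (r < s)%N -> f (x r / x s) != 0)
  (den_xxk : forall (r s : 'I_n) (m : nat), (r < s)%N -> (m <= N)%N ->
     shifted f (x r * x s) q m != 0)
  (den_gy : forall (s : 'I_n.-1) (m : nat), (m <= N)%N ->
     shifteds f [:: g * y s; g / y s] q m != 0)
  (den_gx : forall (r : 'I_n) (m : nat), (m <= N)%N -> shifted f (g * x r) q m != 0)
  (den_qxx : forall (r s : 'I_n) (m : nat), (m <= N)%N ->
     shifted f (q * x r / x s) q m != 0)
  (den_a : ft a != 0)
  (den_K : forall m : nat, (m <= N)%N ->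
     shifteds ft [:: qt; a * qt / b; a * qt / c; a * qt / d;
                 b * c * d * qt ^- N / a; a * qt ^+ N.+1] qt m != 0)
  (den_rhs : shifteds ft [:: a * qt / b; a * qt / c; a * qt / d;
                         a * qt / (b * c * d)] qt N != 0) :
  \sum_(k : {ffun 'I_n -> 'I_N.+1} | (weight k <= N)%N)
    ((\prod_(r < n) \prod_(s < n | (r < s)%N)
        (f (q ^ ((k r)%:Z - (k s)%:Z) * x r / x s)
         / (f (x r / x s) * shifted f (x r * x s) q (k r + k s))))
     * (\prod_(s < n.-1)
          ((\prod_(r < n) shifteds f [:: x r * y s; x r / y s] q (k r))
           / shifteds f [:: g * y s; g / y s] q (weight k)))
     * (\prod_(r < n)
          (shifted f (g * x r) q (weight k) * shifted f (g / x r) q (weight k - k r)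
           / (shifted f (g * x r) q (k r)
              * \prod_(s < n) shifted f (q * x r / x s) q (k r))))
     * q ^+ (\sum_(r < n) r * k r)
     * shifted f q q (weight k)
     * (ft (a * qt ^+ (2 * weight k)) / ft a)
     * (shifteds ft [:: a; b; c; d; a ^+ 2 * qt ^+ (1 + N) / (b * c * d); qt ^- N]
          qt (weight k)
        / shifteds ft [:: qt; a * qt / b; a * qt / c; a * qt / d;
                      b * c * d * qt ^- N / a; a * qt ^+ N.+1] qt (weight k))
     * qt ^+ weight k)
  = shifteds ft [:: a * qt; a * qt / (b * c); a * qt / (b * d); a * qt / (c * d)] qt N
    / shifteds ft [:: a * qt / b; a * qt / c; a * qt / d; a * qt / (b * c * d)] qt N.
Proof.
have factor z k : shifted f z q k != 0 -> forall j, (j < k)%N -> f (z * q ^+ j) != 0.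
  exact: (shifted_neq0 f z q k).2.
have xx_neq0 (i j : 'I_n) : i != j -> f (x i / x j) != 0.
  rewrite neq_ltn => /orP[|] ij; first exact: den_xx.
  rewrite -invf_div (lawV L) ?mulf_neq0 ?invr_eq0 // oppr_eq0 mulf_neq0 ?invr_eq0 ?mulf_neq0 ?invr_eq0 //.
  exact: den_xx.
have qx_neq0 (r s : 'I_n) m : (m < N)%N -> f (q * x r / x s * q ^+ m) != 0.
  by move=> mN; apply: factor mN; apply: den_qxx.
(* Both orders of the indices are needed; for [t > 0] the value at
   [x i / x j * q ^+ t] is a factor of a denominator, and inversion handles
   [t < 0]. *)
have pair_ge (i j : 'I_n) b0 t : i != j -> (b0 + t <= N)%N ->
    f (x i * q ^+ (b0 + t) / (x j * q ^+ b0)) != 0.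
  move=> ij btN; have -> : x i * q ^+ (b0 + t) / (x j * q ^+ b0) = x i / x j * q ^+ t.
    have xj := x_neq0 j; have qb : q ^+ b0 != 0 by rewrite expf_neq0.
    by rewrite exprD; field_nz.
  case: t btN => [|t] btN; first by rewrite mulr1 xx_neq0.
  have H := qx_neq0 i j t; rewrite exprS.
  have -> : x i / x j * (q * q ^+ t) = q * x i / x j * q ^+ t by ring.
  by apply: H; lia.
have pair_neq0 (i j : 'I_n) a0 b0 : i != j -> (a0 <= N)%N -> (b0 <= N)%N ->
    f (x i * q ^+ a0 / (x j * q ^+ b0)) != 0.
  move=> ij aN bN; have [ba|ab] := leqP b0 a0.
    by have := @pair_ge i j b0 (a0 - b0)%N ij; rewrite subnKC //; apply.
  have h : f (x j * q ^+ b0 / (x i * q ^+ a0)) != 0.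
    by have := @pair_ge j i a0 (b0 - a0)%N; rewrite subnKC ?(ltnW ab) // eq_sym; apply.
  have z0 : x j * q ^+ b0 / (x i * q ^+ a0) != 0.
    by rewrite mulf_neq0 ?invr_eq0 ?mulf_neq0 ?expf_neq0.
  by rewrite -invf_div (lawV L) // oppr_eq0 mulf_neq0 ?invr_eq0.
have prod_neq0 (i j : 'I_n) m : i != j -> (m < N)%N -> f (x i * x j * q ^+ m) != 0.
  move=> ij mN; move: ij; rewrite neq_ltn => /orP[|] ij.
    by apply: factor mN; apply: den_xxk.
  by rewrite (mulrC (x i)); apply: factor mN; apply: den_xxk.
have gy_neq0 s m : (m < N)%N -> f (g * y s * q ^+ m) != 0 /\ f (g / y s * q ^+ m) != 0.
  move=> mN; have h := shifteds_neq0 (den_gy s N (leqnn N)).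
  by split; [have := h (g * y s) | have := h (g / y s)];
    rewrite !inE eqxx ?orbT => /(_ isT) /factor; apply.
have gx_neq0 r m : (m < N)%N -> f (g * x r * q ^+ m) != 0.
  by move=> mN; apply: factor mN; apply: den_gx.
have inner m : (m <= N)%N -> \sum_(k : {ffun 'I_n -> 'I_N.+1} | weight k == m)
    inner_term f q x y g (fun r => k r) m = 1.
  by apply: (inner_sum L q_neq0 n_ge1 g_neq0 x_neq0 y_neq0 pair_neq0 prod_neq0
    gy_neq0 gx_neq0 qx_neq0).
pose e := a ^+ 2 * qt ^+ N.+1 / (b * c * d).
pose V := vwp_term ft qt a b c d e N.
have aeE : a * qt / e = b * c * d * qt ^- N / a.
  have qN0 : qt ^+ N != 0 by rewrite expf_neq0.
  by rewrite /e (exprS qt N); field_nz.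
(* The part of the summand that depends on [k] through its weight only. *)
have outerE m : ft (a * qt ^+ (2 * m)) / ft a
     * (shifteds ft [:: a; b; c; d; a ^+ 2 * qt ^+ (1 + N) / (b * c * d); qt ^- N] qt m
        / shifteds ft [:: qt; a * qt / b; a * qt / c; a * qt / d;
                      b * c * d * qt ^- N / a; a * qt ^+ N.+1] qt m)
     * qt ^+ m = V m.
  rewrite -[a ^+ 2 * _ / _]/e -aeE /V /vwp_term -vwp_weightE //.
  by rewrite /shifteds !big_cons !big_nil !mulr1 !mulrA.
transitivity (\sum_(k : {ffun 'I_n -> 'I_N.+1} | (weight k <= N)%N)
    inner_term f q x y g (fun r => k r) (weight k) * V (weight k)).
  apply: eq_bigr => k kN.
  have facts2 u v : shifteds f [:: u; v] q =1 fun k => shifted f u q k * shifted f v q k.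
    by move=> m; rewrite /shifteds !big_cons big_nil mulr1.
  have assoc (X t u w : F) : X * t * u * w = X * (t * u * w) by ring.
  rewrite assoc outerE; congr (_ * _).
  rewrite /inner_term /pair_part /y_part /g_part.
  do 3!congr (_ * _); congr (_ * _).
  apply: eq_bigr => s _; rewrite facts2; congr (_ / _).
  by apply: eq_bigr => r _; rewrite facts2.
rewrite (partition_big (fun k : {ffun 'I_n -> 'I_N.+1} => inord (weight k) : 'I_N.+1) xpredT) //=.
transitivity (\sum_(m < N.+1) V m).
  apply: eq_bigr => m _.
  rewrite -[RHS]mul1r -(inner m) -1?ltnS // mulr_suml; apply: eq_big => [k|k].
    have [kN|kN] := leqP (weight k) N; last first.
      by rewrite gtn_eqF // (leq_trans _ kN) // ltnS -ltnS.
    by rewrite -val_eqE /= inordK.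
  by case/andP=> kN /eqP <-; rewrite inordK.
have rhs_facts := shifteds_neq0 den_rhs; have K_facts := shifteds_neq0 (den_K N (leqnn N)).
rewrite -(big_mkord xpredT V) /V frenkel_turaev //.
- by rewrite /shifteds !big_cons !big_nil !mulr1 !mulrA.
all: try by apply: rhs_facts; rewrite !inE eqxx ?orbT.
all: by apply: K_facts; rewrite !inE eqxx ?orbT.
Qed.

(** * Unconditional sums in the complex numbers *)

(** Summation along the directed set of finite subsets: reindexing and
regrouping come for free, so that double series need no iterated sums. *)
Definition has_sum (K : numDomainType) (T : choiceType) (u : T -> K) (l : K) :=
  forall e, 0 < e -> exists S0 : {fset T}, forall S : {fset T},
    (S0 `<=` S)%fset -> `|\sum_(i <- S) u i - l| < e.

Definition abs_summable (K : numDomainType) (T : choiceType) (u : T -> K) :=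
  exists C, forall S : {fset T}, \sum_(i <- S) `|u i| <= C.

Section HasSum.
Variable K : numFieldType.

Lemma has_sum_unique (T : choiceType) (u : T -> K) l m :
  has_sum u l -> has_sum u m -> l = m.
Proof.
move=> hl hm; apply/eqP; rewrite -subr_eq0 -normr_eq0; apply/negP => /negP n0.
have e0 : 0 < `|l - m| / 2 by rewrite divr_gt0 // lt0r n0 normr_ge0.
have [S1 h1] := hl _ e0; have [S2 h2] := hm _ e0.
have {}h1 := h1 _ (fsubsetUl S1 S2); have {}h2 := h2 _ (fsubsetUr S1 S2).
move: h1 h2; set t := \sum_(_ <- _) _ => h1 h2.
have := ltrD h1 h2; rewrite -splitr distrC => h.
have := ler_normD (l - t) (t - m); rewrite addrA subrK => h'.
by have := le_lt_trans h' h; rewrite ltxx.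
Qed.

Lemma eq_has_sum (T : choiceType) (u v : T -> K) l :
  u =1 v -> has_sum u l -> has_sum v l.
Proof.
by move=> uv h e /h[S0 hS]; exists S0 => S /hS; under eq_bigr do rewrite uv.
Qed.

Lemma has_sumD (T : choiceType) (u v : T -> K) l m :
  has_sum u l -> has_sum v m -> has_sum (fun t => u t + v t) (l + m).
Proof.
move=> hl hm e e0; have e2 : 0 < e / 2 by rewrite divr_gt0.
have [S1 h1] := hl _ e2; have [S2 h2] := hm _ e2.
exists (S1 `|` S2)%fset => S sS; rewrite big_split /= opprD addrACA.
rewrite (le_lt_trans (ler_normD _ _)) // (splitr e) ltrD //.
  by apply: h1; apply: fsubset_trans sS; apply: fsubsetUl.
by apply: h2; apply: fsubset_trans sS; apply: fsubsetUr.
Qed.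

Lemma has_sumZ (T : choiceType) (u : T -> K) l c :
  has_sum u l -> has_sum (fun t => c * u t) (c * l).
Proof.
move=> hl e e0; have c1 : 0 < `|c| + 1 by rewrite ltr_wpDl.
have [S0 h] := hl _ (divr_gt0 e0 c1).
exists S0 => S /h; rewrite -mulr_sumr -mulrBr normrM => {}h.
have [->|cn0] := eqVneq c 0; first by rewrite normr0 mul0r.
rewrite mulrC -ltr_pdivlMr ?normr_gt0 // (lt_trans h) // ltr_pM2l // ltf_pV2 ?posrE ?normr_gt0 //.
by rewrite ltrDl.
Qed.

(** [b'] serves both as the inverse of [b] and as a test for its image: [t] lies
in the image exactly when [b (b' t) = t]. *)
Lemma has_sum_reindex (T T' : choiceType) (b : T -> T') (b' : T' -> T)
    (u : T' -> K) l :
  cancel b b' -> (forall t, u t != 0 -> b (b' t) = t) ->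
  has_sum (fun t => u (b t)) l -> has_sum u l.
Proof.
move=> bK ub hl e /hl[S0 h]; exists [fset b t | t in S0]%fset => S sS.
have binj := can_inj bK.
pose S' := [fset b' t | t in S & b (b' t) == t]%fset.
have -> : \sum_(i <- S) u i = \sum_(i <- S') u (b i).
  rewrite (big_fsetID _ (fun t => b (b' t) == t)) /= addrC big1_seq ?add0r; last first.
    move=> t; rewrite !inE => /andP[_ /andP[_ /negP n]].
    by apply/eqP; apply/negPn/negP => /ub/eqP.
  rewrite /S' big_imfset //= [RHS]big_imfset /=; last first.
    move=> i j /andP[_ /eqP hi] /andP[_ /eqP hj] ij.
    by rewrite -hi -hj ij.
  by rewrite !big_filter; apply: eq_bigr => i /eqP->.
apply: h; apply/fsubsetP => t tS0; apply/imfsetP; exists (b t); rewrite ?bK // !inE bK eqxx andbT.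
by apply: (fsubsetP sS); apply/imfsetP; exists t.
Qed.

Lemma abs_summable_comp (T T' : choiceType) (b : T -> T') (u : T' -> K) :
  injective b -> abs_summable u -> abs_summable (fun t => u (b t)).
Proof.
move=> binj [C h]; exists C => S; have := h [fset b t | t in S]%fset.
by rewrite big_imfset //= => i j _ _; apply: binj.
Qed.

Lemma fset_sum_mono (T : choiceType) (u : T -> K) (S S' : {fset T}) :
  (forall t, 0 <= u t) -> (S `<=` S')%fset ->
  \sum_(i <- S) u i <= \sum_(i <- S') u i.
Proof.
move=> u0 sS; rewrite [leRHS](big_fsetID _ (mem S)) /=.
have -> : \sum_(i <- S) u i = \sum_(i <- [fset x in S' | x \in S]%fset) u i.
  apply: eq_fbigl => t; rewrite !inE; case tS: (t \in S); rewrite ?andbF // andbT.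
  by rewrite (fsubsetP sS).
by rewrite lerDl sumr_ge0.
Qed.

Lemma sum_fsetM (T T' : choiceType) (A : {fset T}) (B : {fset T'}) (u : T * T' -> K) :
  \sum_(i <- (A `*` B)%fset) u i = \sum_(i <- A) \sum_(j <- B) u (i, j).
Proof. by rewrite big_imfset2 // => -[a b] [c d] _ _ /= [-> ->]. Qed.

Lemma abs_summable_prod (T T' : choiceType) (u : T -> K) (v : T' -> K) :
  abs_summable u -> abs_summable v ->
  abs_summable (fun t : T * T' => u t.1 * v t.2).
Proof.
move=> [C hC] [D hD]; exists (C * D) => S.
pose S1 := [fset t.1 | t in S]%fset; pose S2 := [fset t.2 | t in S]%fset.
apply: (@le_trans _ _ (\sum_(i <- (S1 `*` S2)%fset) `|u i.1 * v i.2|)).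
  apply: fset_sum_mono => [t|]; first exact: normr_ge0.
  apply/fsubsetP => -[i j] ij; rewrite in_fsetM; apply/andP.
  by split; apply/imfsetP; exists (i, j).
rewrite sum_fsetM /=.
under eq_bigr => i _ do [under eq_bigr => j _ do rewrite normrM; rewrite -mulr_sumr].
by rewrite -mulr_suml ler_pM ?hC ?hD ?sumr_ge0.
Qed.

Lemma has_sum_single (T : choiceType) (t0 : T) (c : K) :
  has_sum (fun t => if t == t0 then c else 0) c.
Proof.
move=> e e0; exists [fset t0]%fset => S; rewrite fsub1set => t0S.
rewrite (big_fsetD1 t0) //= eqxx big1_seq ?addr0 ?subrr ?normr0 //.
by move=> i; rewrite !inE => /andP[_ /andP[/negbTE-> _]].
Qed.

(** If the sum over the product set exists, finite rectangles, where the partial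
sums are products, are enough to identify it. *)
Lemma has_sum_prod (T T' : choiceType) (u : T -> K) (v : T' -> K) (a b c : K) :
  has_sum u a -> has_sum v b -> has_sum (fun t : T * T' => u t.1 * v t.2) c ->
  c = a * b.
Proof.
move=> hu hv huv; apply/eqP; rewrite -subr_eq0 -normr_le0.
apply/ler_addgt0Pr => e e0; rewrite add0r.
have e3 : 0 < e / 3 by rewrite divr_gt0.
have p1 (x : K) : 0 < `|x| + 1 by rewrite ltr_wpDl.
have [S0 h0] := huv _ e3.
have [S2 h2] := hv _ (divr_gt0 e3 (p1 a)).
pose B := (S2 `|` [fset t.2 | t in S0])%fset.
have {h2} := h2 B (fsubsetUl _ _); set V := \sum_(i <- B) v i => hV.
have [S1 h1] := hu _ (divr_gt0 e3 (p1 V)).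
pose A := (S1 `|` [fset t.1 | t in S0])%fset.
have {h1} := h1 A (fsubsetUl _ _); set U := \sum_(i <- A) u i => hU.
have {h0} := h0 (A `*` B)%fset; rewrite sum_fsetM /=.
under eq_bigr => i _ do rewrite -mulr_sumr.
rewrite -mulr_suml -/U -/V => hUV.
have {}hUV : `|U * V - c| < e / 3.
  apply: hUV; apply/fsubsetP => -[i j] ij; rewrite in_fsetM; apply/andP.
  by split; rewrite in_fsetU; apply/orP; right; apply/imfsetP; exists (i, j).
have -> : c - a * b = (c - U * V) + ((U - a) * V + a * (V - b)) by ring.
have -> : e = e / 3 + (e / 3 + e / 3) by field.
apply: le_trans (ler_normD _ _) _; rewrite distrC; apply: lerD; first exact: ltW.
apply: le_trans (ler_normD _ _) _; rewrite !normrM; apply: lerD.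
  rewrite ltr_pdivlMr // in hU; apply: le_trans (ltW hU).
  by rewrite ler_wpM2l // lerDl.
rewrite ltr_pdivlMr // in hV; apply: le_trans (ltW hV); rewrite mulrC.
by rewrite ler_wpM2l // lerDl.
Qed.

End HasSum.

Section Complete.
Variable R : realType.

Lemma nonneg_has_sum (T : choiceType) (v : T -> R) (C : R) :
  (forall t, 0 <= v t) -> (forall S : {fset T}, \sum_(i <- S) v i <= C) ->
  exists l, has_sum v l.
Proof.
move=> v0 hC.
pose E : set R := [set x | exists S : {fset T}, x = \sum_(i <- S) v i]%classic.
have Esup : has_sup E.
  split; first by exists (\sum_(i <- (fset0 : {fset T})) v i), fset0.
  by exists C => x [S ->].
exists (sup E) => e e0; have [x [S0 ->] hx] := sup_adherent e0 Esup.
exists S0 => S sS; rewrite distrC ger0_norm; last first.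
  by rewrite subr_ge0; apply: ub_le_sup; [exact: Esup.2 | exists S].
rewrite ltrBlDr addrC -ltrBlDr; apply: lt_le_trans hx _.
exact: fset_sum_mono.
Qed.

Lemma real_has_sum (T : choiceType) (v : T -> R) :
  abs_summable v -> exists l, has_sum v l.
Proof.
move=> [C hC].
have [l1 h1] : exists l, has_sum (fun t => `|v t|) l.
  by apply: (@nonneg_has_sum _ _ C) => [t|//]; exact: normr_ge0.
have [l2 h2] : exists l, has_sum (fun t => `|v t| + v t) l.
  apply: (@nonneg_has_sum _ _ (C + C)) => [t|S].
    by rewrite addrC -lerBlDr sub0r lerNl ler_normr lexx orbT.
  rewrite big_split /=; apply: lerD => //; apply: le_trans (hC S).
  by apply: ler_sum => i _; apply: ler_norm.
exists (l2 + -1 * l1).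
have := has_sumD h2 (has_sumZ (-1) h1).
by congr has_sum; apply: funext => t; rewrite mulN1r addrAC subrr add0r.
Qed.

Lemma has_sum_real_complex (T : choiceType) (v : T -> R) l :
  has_sum v l -> has_sum (fun t => (v t)%:C%C) l%:C%C.
Proof.
move=> h e e0; have er : e = (complex.Re e)%:C%C by rewrite RRe_real // gtr0_real.
have e0' : 0 < complex.Re e by move: e0; rewrite er ltcR.
have [S0 hS] := h _ e0'; exists S0 => S /hS hlt.
rewrite er -rmorph_sum -rmorphB /=.
have -> (x : R) : `|x%:C%C| = `|x|%:C%C by rewrite normc_def /= expr0n addr0 sqrtr_sqr.
by rewrite ltcR.
Qed.

Lemma abs_summable_Re (T : choiceType) (u : T -> R[i]) :
  abs_summable u -> abs_summable (fun t => complex.Re (u t)).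
Proof.
move=> [C hC]; exists (complex.Re C) => S.
have C0 : 0 <= C by apply: le_trans (hC fset0); rewrite sumr_ge0.
rewrite -lecR RRe_real ?ger0_real //; apply: le_trans (hC S).
by rewrite rmorph_sum /= ler_sum // => i _; apply: normc_ge_Re.
Qed.

Lemma complex_has_sum (T : choiceType) (u : T -> R[i]) :
  abs_summable u -> exists l, has_sum u l.
Proof.
move=> hu; have [l1 h1] := real_has_sum (abs_summable_Re hu).
have [l2 h2] : exists l, has_sum (fun t => complex.Re (u t * 'i%C)) l.
  apply: real_has_sum; apply: abs_summable_Re.
  have [C hC] := hu; exists C => S; apply: le_trans (hC S).
  rewrite ler_sum // => i _; rewrite normrM.
  by rewrite [X in _ * X](_ : _ = 1) ?mulr1 // normc_def /= expr0n expr1n add0r sqrtr1.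
have h1' := has_sum_real_complex h1; have h2' := has_sum_real_complex h2.
exists (l1%:C%C + (- 'i%C) * l2%:C%C).
have := has_sumD h1' (has_sumZ (- 'i%C) h2').
congr has_sum; apply: funext => t.
by rewrite [RHS]complexE ReiNIm rmorphN mulrNN.
Qed.

End Complete.

Section Limits.
Local Open Scope classical_set_scope.
Local Open Scope ring_scope.
Variable R : realType.

Lemma fset_sum_split (T : choiceType) (w : T -> R[i]) (S0 S : {fset T}) :
  (S0 `<=` S)%fset ->
  \sum_(i <- S) w i = \sum_(i <- S0) w i + \sum_(i <- S | i \notin S0) w i.
Proof.
move=> sS; rewrite (bigID (mem S0)) /=; congr (_ + _).
rewrite -big_filter; apply: perm_big; apply: uniq_perm => [||t].
- by rewrite filter_uniq.
- exact: fset_uniq.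
- by rewrite mem_filter /=; case tS: (t \in S0) => //=; rewrite (fsubsetP sS).
Qed.

Lemma abs_summable_tail (T : choiceType) (g : T -> R[i]) e :
  abs_summable g -> 0 < e -> exists S0 : {fset T}, forall S : {fset T},
  (S0 `<=` S)%fset -> \sum_(i <- S | i \notin S0) `|g i| < e.
Proof.
move=> [C hC] e0.
have [l hl] : exists l, has_sum (fun t => `|g t|) l.
  apply: complex_has_sum; exists C => S; apply: le_trans (hC S).
  by apply: ler_sum => i _; rewrite normr_id.
have [S0 h] := hl _ (divr_gt0 e0 (ltr0n _ 2)); exists S0 => S sS.
have h1 := h _ (fsubset_refl S0); have h2 := h _ sS.
rewrite -[X in X < _]ger0_norm ?sumr_ge0 //.
have -> : \sum_(i <- S | i \notin S0) `|g i| =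
    (\sum_(i <- S) `|g i| - l) - (\sum_(i <- S0) `|g i| - l).
  by rewrite (fset_sum_split _ sS); ring.
by apply: le_lt_trans (ler_normB _ _) _; rewrite (splitr e) ltrD.
Qed.

(** Dominated convergence for series: outside a finite set all the series are
uniformly small, and on a finite set pointwise convergence suffices. *)
Lemma dominated_sum (T : choiceType) (u : nat -> T -> R[i]) (v g : T -> R[i])
    (s : nat -> R[i]) (l : R[i]) :
  abs_summable g -> (forall n t, `|u n t| <= `|g t|) ->
  (forall t, `|v t| <= `|g t|) ->
  (forall t, (u ^~ t : nat -> R[i]^o) @ \oo --> (v t : R[i]^o)) ->
  (forall n, has_sum (u n) (s n)) -> has_sum v l ->
  (s : nat -> R[i]^o) @ \oo --> (l : R[i]^o).
Proof.
move=> hg hu hv uv hs hl; apply/cvgrPdist_lt => e e0.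
have e5 : 0 < e / 5 by rewrite divr_gt0.
have [S0 hS0] := abs_summable_tail hg e5.
have fin (t : seq T) d : 0 < d ->
    \forall n \near \oo, `|\sum_(i <- t) v i - \sum_(i <- t) u n i| < d.
  elim: t d => [|i t IH] d d0.
    by apply: nearW => n; rewrite !big_nil subrr normr0.
  have d2 : 0 < d / 2 by rewrite divr_gt0.
  have /cvgrPdist_lt/(_ _ d2) := uv i; apply: filterS2 (IH _ d2) => n h1 h2.
  rewrite !big_cons opprD addrACA; apply: le_lt_trans (ler_normD _ _) _.
  by rewrite (splitr d) ltrD.
have := fin S0 _ e5.
apply: filterS => n hn.
have [S1 h1] := hs n _ e5; have [S2 h2] := hl _ e5.
pose S := (S0 `|` (S1 `|` S2))%fset.
have {}h1 : `|\sum_(i <- S) u n i - s n| < e / 5.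
  by apply: h1; rewrite /S fsetUCA fsubsetUl.
have {}h2 : `|\sum_(i <- S) v i - l| < e / 5.
  by apply: h2; rewrite /S fsetUA fsubsetUr.
have sub : (S0 `<=` S)%fset by apply: fsubsetUl.
have tail (w : T -> R[i]) : (forall t, `|w t| <= `|g t|) ->
    `|\sum_(i <- S | i \notin S0) w i| < e / 5.
  move=> hw; apply: le_lt_trans (hS0 S sub); apply: le_trans (ler_norm_sum _ _ _) _.
  exact: ler_sum.
have t1 := tail _ (hu n); have t2 := tail _ hv.
rewrite !(fset_sum_split _ sub) in h1 h2.
move: h1 h2 hn t1 t2.
move: (\sum_(i <- S0) u n i) (\sum_(i <- S0) v i)
  (\sum_(i <- S | i \notin S0) u n i) (\sum_(i <- S | i \notin S0) v i) => a b c d h1 h2 h3 h4 h5.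
have -> : l - s n = (a + c - s n) - c + (b - a) + d - (b + d - l) by ring.
have -> : e = e / 5 + e / 5 + e / 5 + e / 5 + e / 5 by field.
apply: le_lt_trans (ler_normB _ _) _; apply: ltrD => //.
apply: le_lt_trans (ler_normD _ _) _; apply: ltrD => //.
apply: le_lt_trans (ler_normD _ _) _; apply: ltrD => //.
by apply: le_lt_trans (ler_normB _ _) _; apply: ltrD.
Qed.

Lemma has_sum_series (u : nat -> R[i]) (l : R[i]) : has_sum u l ->
  ((fun n => \sum_(0 <= i < n) u i) : nat -> R[i]^o) @ \oo --> (l : R[i]^o).
Proof.
move=> h; apply/cvgrPdist_lt => e e0; have [S0 hS0] := h _ e0.
exists (\max_(i <- S0) i).+1 => // n /= hn; rewrite distrC.
have -> : \sum_(0 <= i < n) u i = \sum_(i <- [fset i in iota 0 n]%fset) u i.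
  apply: perm_big; apply: uniq_perm; rewrite ?iota_uniq ?fset_uniq // => i.
  by rewrite !inE mem_index_iota mem_iota.
apply: hS0; apply/fsubsetP => i iS; rewrite !inE mem_iota /=.
by apply: leq_trans hn; rewrite ltnS; apply: leq_bigmax_seq.
Qed.

End Limits.

(** * The Jacobi triple product *)

Section RatioTest.
Local Open Scope classical_set_scope.
Local Open Scope ring_scope.
Variable R : realType.

Lemma geometric_summable (u : nat -> R[i]) (C r : R) :
  0 <= r < 1 -> (forall n, `|u n| <= (C * r ^+ n)%:C%C) -> abs_summable u.
Proof.
move=> /andP[r0 r1] hu; have r1' : 0 < 1 - r by rewrite subr_gt0.
have C0 : 0 <= C.
  have := le_trans (normr_ge0 _) (hu 0%N).
  by rewrite expr0 mulr1 ler0c.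
exists (C / (1 - r))%:C%C => S.
have [N hN] : exists N, forall i, i \in S -> (i < N)%N.
  exists (\max_(i <- S) i).+1 => i iS; rewrite ltnS.
  by apply: leq_bigmax_seq.
have {hN} sub : (S `<=` [fset i in iota 0 N])%fset.
  by apply/fsubsetP => i iS; rewrite !inE mem_iota /= hN.
apply: le_trans (fset_sum_mono _ sub) _ => [t|]; first exact: normr_ge0.
have -> : \sum_(i <- [fset i in iota 0 N]%fset) `|u i| = \sum_(0 <= i < N) `|u i|.
  apply: perm_big; apply: uniq_perm; rewrite ?iota_uniq ?fset_uniq // => i.
  by rewrite !inE mem_index_iota mem_iota.
apply: (@le_trans _ _ (\sum_(0 <= i < N) (C * r ^+ i)%:C%C)).
  by apply: ler_sum => i _; apply: hu.
rewrite -rmorph_sum lecR /= -mulr_sumr ler_wpM2l // -[leRHS]mul1r ler_pdivlMr //.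
have : (1 - r) * (\sum_(0 <= i < N) r ^+ i) <= 1.
  by rewrite big_mkord -opprB mulNr -subrX1 opprB gerBl exprn_ge0.
by rewrite mulrC.
Qed.

(** Once [r ^+ n * X <= 1/2] the sequence [2 ^+ n * `|u n|] decreases, so that
[u] is dominated by a geometric sequence. *)
Lemma ratio_summable (u : nat -> R[i]) (r X : R) :
  0 <= r < 1 -> 0 <= X -> (forall n, `|u n.+1| <= (r ^+ n * X)%:C%C * `|u n|) ->
  abs_summable u.
Proof.
move=> /andP[r0 r1] X0 hu.
pose a n := complex.Re `|u n|.
have aE n : `|u n| = (a n)%:C%C by rewrite /a RRe_real // normr_real.
have a0 n : 0 <= a n by rewrite -ler0c -aE.
have ha n : a n.+1 <= r ^+ n * X * a n.
  by have := hu n; rewrite !aE -rmorphM lecR.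
have [n0 hn0] : exists n0, forall n, (n0 <= n)%N -> r ^+ n * X <= 2^-1.
  have X1 : 0 < X + 1 by rewrite ltr_wpDl.
  have /cvgrPdist_lt/(_ (2^-1 / (X + 1))) : (GRing.exp r : nat -> R) @ \oo --> (0 : R).
    by apply: cvg_expr; rewrite ger0_norm.
  rewrite divr_gt0 ?invr_gt0 // => /(_ isT)[n0 _ h]; exists n0 => n /h /=.
  rewrite sub0r normrN ger0_norm ?exprn_ge0 // ltr_pdivlMr // => h'.
  by apply: le_trans (ltW h'); rewrite ler_wpM2l ?exprn_ge0 // lerDl.
pose v n := 2 ^+ n * a n.
have v0 n : 0 <= v n by rewrite mulr_ge0 ?exprn_ge0.
pose M := \sum_(i < n0.+1) v i.
have vS n : (n0 <= n)%N -> v n.+1 <= v n.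
  move=> nn; rewrite /v exprSr -mulrA ler_wpM2l ?exprn_ge0 //.
  rewrite -ler_pdivlMl //; apply: le_trans (ha n) _.
  by rewrite ler_wpM2r // hn0.
have vM n : v n <= M.
  elim: n => [|n IH]; first by rewrite /M big_ord_recl lerDl sumr_ge0.
  have [nn0|/vS] := ltnP n n0; last by move/le_trans; apply.
  by rewrite /M (bigD1 (Ordinal (nn0 : (n.+1 < n0.+1)%N))) //= lerDl sumr_ge0.
apply: (@geometric_summable _ M 2^-1); first by lra.
move=> n; rewrite aE lecR exprVn ler_pdivlMr ?exprn_gt0 // mulrC; exact: vM.
Qed.

End RatioTest.

Section Euler.
Local Open Scope classical_set_scope.
Local Open Scope ring_scope.
Variable R : realType.

(** [(p; p)_n], whose quotients are the Gaussian binomial coefficients of the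
finite triple product. *)
Definition euler_prod (p : R[i]) (n : nat) : R[i] := \prod_(0 <= j < n) (1 - p ^+ j.+1).

Lemma prod_le_exp (c : nat -> R) (K r : R) n : 0 <= r < 1 -> 0 <= K ->
  (forall j, 0 <= c j <= 1 + K * r ^+ j) ->
  \prod_(0 <= j < n) c j <= expR (K / (1 - r)).
Proof.
move=> /andP[r0 r1] K0 hc; have r1' : 0 < 1 - r by rewrite subr_gt0.
apply: (@le_trans _ _ (\prod_(0 <= j < n) expR (K * r ^+ j))).
  apply: ler_prod => j _; have /andP[-> h] /= := hc j.
  by apply: le_trans h _; apply: expR_ge1Dx.
rewrite -expR_sum ler_expR -mulr_sumr ler_wpM2l // -[leRHS]mul1r ler_pdivlMr //.
rewrite big_mkord mulrC; have := subrX1 r n.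
have : 0 <= r ^+ n by rewrite exprn_ge0.
move=> h1 h2; rewrite -[_ * _]opprK -mulNr opprB -h2; lra.
Qed.

Variable p : R[i].
Hypothesis p_lt1 : `|p| < 1.

Let r : R := complex.Re `|p|.
Let rE : `|p| = r%:C%C. Proof. by rewrite /r RRe_real // normr_real. Qed.
Let r01 : 0 <= r < 1.
Proof. by rewrite -ler0c -ltcR -rE normr_ge0. Qed.

Lemma norm_complexR (x : R[i]) : exists2 t : R, 0 <= t & `|x| = t%:C%C.
Proof.
exists (complex.Re `|x|); last by rewrite RRe_real // normr_real.
by rewrite -ler0c RRe_real ?normr_real // normr_ge0.
Qed.

Lemma norm_prod_le (c : nat -> R[i]) (K : R) n : 0 <= K ->
  (forall j, `|c j| <= (1 + K * r ^+ j)%:C%C) ->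
  `|\prod_(0 <= j < n) c j| <= (expR (K / (1 - r)))%:C%C.
Proof.
move=> K0 hc; rewrite normr_prod.
have cE j : `|c j| = (complex.Re `|c j|)%:C%C by rewrite RRe_real // normr_real.
under eq_bigr do rewrite cE.
rewrite -rmorph_prod lecR; apply: prod_le_exp => // j.
by rewrite -ler0c -lecR -cE normr_ge0 hc.
Qed.

Lemma euler_factor_neq0 j : 1 - p ^+ j.+1 != 0.
Proof.
rewrite subr_eq0; apply: contraTneq isT => h.
have : `|p ^+ j.+1| < 1 by rewrite normrX exprn_ilt1.
by rewrite -h normr1 ltxx.
Qed.

Lemma euler_prod_neq0 n : euler_prod p n != 0.
Proof.
by rewrite /euler_prod prodf_seq_neq0; apply/allP => j _; apply: euler_factor_neq0.
Qed.

Lemma euler_prodS n : euler_prod p n.+1 = euler_prod p n * (1 - p ^+ n.+1).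
Proof. by rewrite /euler_prod big_nat_recr. Qed.

Lemma euler_prod_bounded : exists C, forall n, `|euler_prod p n| <= C%:C%C.
Proof.
exists (expR (1 / (1 - r))) => n; apply: norm_prod_le => // j.
apply: le_trans (ler_normB _ _) _; rewrite normr1 normrX rE -rmorphXn mul1r rmorphD rmorph1 lerD2l lecR.
have /andP[r0 r1] := r01.
by rewrite exprS ler_piMl ?exprn_ge0 // ltW.
Qed.

(** Uses [1 / (1 - t) <= 1 + t / (1 - r)] for [t = r ^+ j.+1 <= r]. *)
Lemma euler_inv_bounded : exists C, forall n, `|(euler_prod p n)^-1| <= C%:C%C.
Proof.
have /andP[r0 r1] := r01; have r1' : 0 < 1 - r by rewrite subr_gt0.
exists (expR (1 / (1 - r) / (1 - r))) => n; rewrite /euler_prod -prodfV.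
apply: norm_prod_le => [|j]; first by rewrite divr_ge0 // ltW.
rewrite normfV.
have rj : r ^+ j.+1 <= r by rewrite exprS ler_piMr // exprn_ile1 // ltW.
have rj1 : 0 < 1 - r ^+ j.+1 by lra.
apply: (@le_trans _ _ ((1 - r ^+ j.+1)^-1)%:C%C).
  rewrite fmorphV lef_pV2 ?posrE ?normr_gt0 ?euler_factor_neq0 //; last by rewrite ltcR.
  have := lerB_dist 1 (p ^+ j.+1).
  by rewrite normr1 normrX rE -rmorphXn rmorphB rmorph1.
rewrite lecR -[_^-1]mul1r ler_pdivrMr //.
have r2 : r ^+ j.+1 <= r ^+ j by rewrite exprS ler_piMl ?exprn_ge0 // ltW.
have rj0 : 0 <= r ^+ j.+1 by rewrite exprn_ge0.
rewrite mul1r; set s := r ^+ j in r2 *; set t := r ^+ j.+1 in rj rj1 r2 rj0 *.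
have : t <= (1 - r)^-1 * s * (1 - t).
  apply: (@le_trans _ _ ((1 - r)^-1 * s * (1 - r))).
    by rewrite mulrAC mulVf ?mul1r // gt_eqF.
  rewrite ler_wpM2l ?mulr_ge0 ?invr_ge0 ?(ltW r1') ?exprn_ge0 //; lra.
lra.
Qed.

End Euler.

(** The triangular number [k (k - 1) / 2], as a natural number because it is
the exponent of [p], which may be zero. *)
Definition tri (k : int) : nat := (absz (k * (k - 1)%R)%R)./2.

Lemma triE (k : int) : (tri k)%:Z * 2 = k * (k - 1).
Proof.
have k0 : 0 <= k * (k - 1) by nia.
suff: (tri k * 2)%N%:Z = (absz (k * (k - 1)))%:Z by rewrite PoszM => ->; rewrite gez0_abs.
congr Posz; rewrite /tri muln2 even_halfK // abszM oddM.
by case: k {k0} => [[|n]|n] //=; rewrite ?subn1 ?subSS ?subn0 /=; lia.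
Qed.

Section TripleProduct.
Local Open Scope classical_set_scope.
Local Open Scope ring_scope.
Variable R : realType.

Lemma geometric_steps_cvg (a w : nat -> R[i]) (C r : R) : 0 <= r < 1 ->
  (forall n, a n.+1 = a n + w n) -> (forall n, `|w n| <= (C * r ^+ n)%:C%C) ->
  exists l : R[i], (a : nat -> R[i]^o) @ \oo --> (l : R[i]^o).
Proof.
move=> r01 ha hw; have [l hl] := complex_has_sum (geometric_summable r01 hw).
exists (a 0%N + l); set c := a 0%N.
have -> : a = (fun n => c + \sum_(0 <= i < n) w i).
  apply: funext; elim=> [|n IH]; first by rewrite big_geq // addr0.
  by rewrite big_nat_recr //= addrA -IH.
apply/cvgrPdist_lt => e e0.
have /cvgrPdist_lt/(_ e e0) := has_sum_series hl.
by apply: filterS => n /=; rewrite opprD addrACA subrr add0r.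
Qed.

Variable p : R[i].
Hypothesis p_lt1 : `|p| < 1.

Let r : R := complex.Re `|p|.
Let rE : `|p| = r%:C%C. Proof. by rewrite /r RRe_real // normr_real. Qed.
Let r01 : 0 <= r < 1.
Proof. by rewrite -ler0c -ltcR -rE normr_ge0 p_lt1. Qed.

Let le_pr (a : nat -> R[i]) (C : R) : (forall n, `|a n| <= C%:C%C) ->
  forall n, `|a n * p ^+ n.+1| <= (C * r ^+ n)%:C%C.
Proof.
move=> ha n; have /andP[r0 r1] := r01.
have C0 : 0 <= C by rewrite -ler0c; apply: le_trans (normr_ge0 _) (ha 0%N).
rewrite normrM normrX rE -rmorphXn rmorphM; apply: ler_pM => //.
  by rewrite ler0c exprn_ge0.
by rewrite lecR exprS ler_piMl ?exprn_ge0 // ltW.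
Qed.

Lemma euler_prod_cvg :
  exists l : R[i], (euler_prod p : nat -> R[i]^o) @ \oo --> (l : R[i]^o).
Proof.
have [C hC] := euler_prod_bounded p_lt1.
apply: (@geometric_steps_cvg _ (fun n => - euler_prod p n * p ^+ n.+1) C r) => // n.
  by rewrite euler_prodS; ring.
by apply: (le_pr (a := fun n => - euler_prod p n)) => {}n; rewrite normrN.
Qed.

Lemma euler_inv_cvg : exists l : R[i],
  ((fun n => (euler_prod p n)^-1) : nat -> R[i]^o) @ \oo --> (l : R[i]^o).
Proof.
have [C hC] := euler_inv_bounded p_lt1.
apply: (@geometric_steps_cvg _ (fun n => (euler_prod p n.+1)^-1 * p ^+ n.+1) C r) => // n.
  rewrite euler_prodS; field.
  by rewrite euler_prod_neq0 // (euler_factor_neq0 p_lt1).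
by apply: (le_pr (a := fun n => (euler_prod p n.+1)^-1)).
Qed.

(** The reciprocal of [(p; p)_k] extended by zero to negative [k].  With this
value the recurrence [1/(p; p)_(k-1) = (1 - p^k)/(p; p)_k] holds for all [k],
so that the range of summation in the triple product need not be mentioned. *)
Definition euler_invz (k : int) : R[i] := if k is Posz n then (euler_prod p n)^-1 else 0.

Lemma euler_invz_pred (i : nat) :
  euler_invz (i%:Z - 1) = (1 - p ^+ i) * euler_invz i.
Proof.
case: i => [|i]; first by rewrite subrr mul0r.
rewrite intS addrC addKr /= euler_prodS; field.
by rewrite euler_prod_neq0 // (euler_factor_neq0 p_lt1).
Qed.

Lemma euler_invz_pred2 (i : nat) :
  euler_invz (i%:Z - 2) = (1 - p ^+ i.-1) * (1 - p ^+ i) * euler_invz i.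
Proof.
case: i => [|i]; first by rewrite subrr mulr0 mul0r.
have -> : i.+1%:Z - 2 = i%:Z - 1 by lia.
rewrite euler_invz_pred -mulrA -(euler_invz_pred i.+1).
by congr (_ * euler_invz _); lia.
Qed.

(** The Gaussian binomial coefficient with upper index [2 m] and lower index
[m + k]. *)
Definition triple_coef (m : nat) (k : int) : R[i] :=
  euler_prod p (2 * m) * euler_invz (m%:Z - k) * euler_invz (m%:Z + k).

(** The effect on coefficients of multiplying by
[(1 + X p^m) (1 + p^(m+1) / X)]. *)
Lemma triple_coef_rec (m : nat) (k : int) :
  p ^+ tri k * triple_coef m.+1 k =
  (1 + p ^+ (2 * m).+1) * (p ^+ tri k * triple_coef m k)
  + p ^+ m * (p ^+ tri (k - 1) * triple_coef m (k - 1))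
  + p ^+ m.+1 * (p ^+ tri (k + 1) * triple_coef m (k + 1)).
Proof.
rewrite /triple_coef.
have neg z : z < 0 -> euler_invz z = 0 by case: z.
have [ki|ki] := leP 0 (m.+1%:Z - k); last first.
  rewrite [euler_invz (m.+1%:Z - k)]neg // [euler_invz (m%:Z - k)]neg; last lia.
  rewrite [euler_invz (m%:Z - (k - 1))]neg; last lia.
  rewrite [euler_invz (m%:Z - (k + 1))]neg; last lia.
  by rewrite !(mulr0, mul0r, addr0).
have [kj|kj] := leP 0 (m.+1%:Z + k); last first.
  rewrite [euler_invz (m.+1%:Z + k)]neg // [euler_invz (m%:Z + k)]neg; last lia.
  rewrite [euler_invz (m%:Z + (k - 1))]neg; last lia.
  rewrite [euler_invz (m%:Z + (k + 1))]neg; last lia.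
  by rewrite !(mulr0, addr0).
have [i iE] : exists i : nat, i%:Z = m.+1%:Z - k by exists (absz (m.+1%:Z - k)); rewrite gez0_abs.
have [j jE] : exists j : nat, j%:Z = m.+1%:Z + k by exists (absz (m.+1%:Z + k)); rewrite gez0_abs.
rewrite -iE -jE.
have -> : m%:Z - k = i%:Z - 1 by lia.
have -> : m%:Z + k = j%:Z - 1 by lia.
have -> : m%:Z - (k - 1) = i%:Z by lia.
have -> : m%:Z + (k - 1) = j%:Z - 2 by lia.
have -> : m%:Z - (k + 1) = i%:Z - 2 by lia.
have -> : m%:Z + (k + 1) = j%:Z by lia.
rewrite !euler_invz_pred2 !euler_invz_pred.
(* The powers of [p] that the shifts of [k] contribute. *)
have e1 : (m + tri (k - 1) = tri k + i)%N.
  by have := triE k; have := triE (k - 1); nia.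
have e2 : (m.+1 + tri (k + 1) = tri k + j)%N.
  by have := triE k; have := triE (k + 1); nia.
rewrite !(mulrA (p ^+ _) (p ^+ tri _)) -!exprD e1 e2 !exprD.
have -> : (2 * m.+1 = (2 * m).+2)%N by lia.
rewrite 2!euler_prodS.
have ij : (i + j = (2 * m).+2)%N by lia.
have -> : p ^+ (2 * m).+2 = p ^+ i * p ^+ j by rewrite -exprD ij.
have hj : (1 - p ^+ j) * (p ^+ i * p ^+ j.-1) = (1 - p ^+ j) * p ^+ (2 * m).+1.
  case: j ij {jE e2} => [|j] ij; first by rewrite expr0 subrr !mul0r.
  by rewrite -exprD; congr (_ * _ ^+ _); lia.
have hi : (1 - p ^+ i) * (p ^+ j * p ^+ i.-1) = (1 - p ^+ i) * p ^+ (2 * m).+1.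
  case: i ij {iE e1 hj} => [|i] ij; first by rewrite expr0 subrr !mul0r.
  by rewrite -exprD; congr (_ * _ ^+ _); lia.
set w := p ^+ (2 * m).+1 in hi hj *.
set P := p ^+ i in hi hj *; set Q := p ^+ j in hi hj *.
set P' := p ^+ i.-1 in hi *; set Q' := p ^+ j.-1 in hj *.
pose M := p ^+ tri k * euler_prod p (2 * m) * euler_invz i * euler_invz j.
transitivity (M * ((1 - w) * (1 - P * Q))); first by rewrite /M; ring.
transitivity (M * ((1 + w) * (1 - P) * (1 - Q) + ((1 - Q) * P - (1 - Q) * (P * Q'))
   + ((1 - P) * Q - (1 - P) * (Q * P')))).
  by rewrite hi hj; ring.
by rewrite /M; ring.
Qed.

End TripleProduct.

Section Jacobi.
Local Open Scope classical_set_scope.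
Local Open Scope ring_scope.
Variable R : realType.

Variable p : R[i].
Hypothesis p_lt1 : `|p| < 1.

Definition jacobi_term (X : R[i]) (k : int) : R[i] := p ^+ tri k * X ^ k.

Lemma abs_summable_int (u : int -> R[i]) :
  abs_summable (fun n => u (Posz n)) -> abs_summable (fun n => u (Negz n)) ->
  abs_summable u.
Proof.
move=> [C hC] [D hD]; exists (C + D) => S.
rewrite (bigID (fun k => 0 <= k)) /=; apply: lerD.
  apply: le_trans (hC [fset absz k | k in S & 0 <= k]%fset).
  rewrite big_imfset /=; last first.
    by move=> i j /andP[_ hi] /andP[_ hj] ij; rewrite -(gez0_abs hi) ij gez0_abs.
  by rewrite big_filter le_eqVlt; apply/orP; left; apply/eqP;
    apply: eq_bigr => i hi; rewrite gez0_abs.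
apply: le_trans (hD [fset (absz k).-1 | k in S & ~~ (0 <= k)]%fset).
have negE k : ~~ (0 <= k) -> Negz (absz k).-1 = k by case: k.
rewrite big_imfset /=; last first.
  by move=> i j /andP[_ hi] /andP[_ hj] ij; rewrite -(negE _ hi) ij negE.
by rewrite big_filter le_eqVlt; apply/orP; left; apply/eqP;
  apply: eq_bigr => i hi; rewrite negE.
Qed.

(** Quadratic exponents: the ratio of consecutive terms tends to zero in both
directions. *)
Lemma jacobi_summable X : X != 0 -> abs_summable (jacobi_term X).
Proof.
move=> X0; have [r r0 rE] := norm_complexR p.
have r01 : 0 <= r < 1 by rewrite r0 -ltcR -rE p_lt1.
have [t t0 tE] := norm_complexR X; have [s s0 sE] := norm_complexR X^-1.
apply: abs_summable_int.
  apply: (@ratio_summable _ _ r t) => // n.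
  have e : tri n.+1 = (n + tri n)%N.
    by have := triE n; have := triE n.+1; lia.
  rewrite /jacobi_term e exprD -!exprnP exprS.
  have -> : (r ^+ n * t)%:C%C = `|p ^+ n * X|.
    by rewrite normrM normrX rE tE rmorphM rmorphXn.
  rewrite -!normrM.
  by rewrite le_eqVlt; apply/orP; left; apply/eqP; congr `|_|; ring.
apply: (@ratio_summable _ _ r s) => // n.
have e : tri (Negz n.+1) = (n + (2 + tri (Negz n)))%N.
  by have := triE (Negz n); have := triE (Negz n.+1); lia.
rewrite /jacobi_term e !exprD !NegzE -!exprnN (exprS _ n.+1).
have -> : (r ^+ n * s)%:C%C = `|p ^+ n * X^-1|.
  by rewrite normrM normrX rE sE rmorphM rmorphXn.
rewrite -normrM.
rewrite invfM (_ : _ * _ = p ^+ 2 * (p ^+ n * X^-1 * (p ^+ tri (- n.+1%:Z) * X ^- n.+1))); last by ring.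
rewrite [leLHS]normrM ler_piMl // normrX exprn_ile1 // ltW //.
Qed.

(** The finite Jacobi triple product, stated as an unconditional sum over all
integers; the coefficients vanish for [`|k| > m]. *)
Lemma has_sum_triple (m : nat) X : X != 0 ->
  has_sum (fun k : int => p ^+ tri k * triple_coef p m k * X ^ k)
    (\prod_(0 <= j < m) ((1 + X * p ^+ j) * (1 + p ^+ j.+1 / X))).
Proof.
move=> X0; elim: m => [|m IH].
  rewrite big_geq //; have := has_sum_single (0 : int) (1 : R[i]).
  congr has_sum; apply: funext => k.
  have neg z : z < 0 -> euler_invz p z = 0 by case: z.
  rewrite /triple_coef; have [kl|kg|->] := ltgtP k 0.
  - by rewrite [euler_invz p (0%:Z + k)]neg ?add0r // !(mulr0, mul0r).
  - by rewrite [euler_invz p (0%:Z - k)]neg ?sub0r ?oppr_lt0 // !(mulr0, mul0r).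
  - by rewrite /= /euler_prod !big_geq //= invr1 !mulr1.
rewrite big_nat_recr //=; set P := \prod_(_ <= _ < _) _ in IH *.
set u := (fun k : int => _) in IH.
have up : has_sum (fun k => u (k - 1)) P.
  apply: (@has_sum_reindex _ _ _ (fun k => k + 1) (fun k => k - 1)) => [k|k _|].
  - by rewrite addrK.
  - by rewrite subrK.
  - by move: IH; congr has_sum; apply: funext => k; rewrite addrK.
have down : has_sum (fun k => u (k + 1)) P.
  apply: (@has_sum_reindex _ _ _ (fun k => k - 1) (fun k => k + 1)) => [k|k _|].
  - by rewrite subrK.
  - by rewrite addrK.
  - by move: IH; congr has_sum; apply: funext => k; rewrite subrK.
have := has_sumD (has_sumD (has_sumZ (1 + p ^+ (2 * m).+1) IH)
  (has_sumZ (X * p ^+ m) up)) (has_sumZ (p ^+ m.+1 / X) down).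
congr has_sum; last first.
  rewrite (_ : (2 * m).+1 = m + m.+1)%N; last lia.
  by rewrite exprD; field.
apply: funext => k; rewrite /u (triple_coef_rec p_lt1) !expfzDr // expr1z exprN1.
by field.
Qed.

Lemma euler_invz_cvg (f : nat -> int) (h : nat) (l : R[i]) :
  (forall m, m%:Z <= f m + h%:Z) ->
  ((fun n => (euler_prod p n)^-1) : nat -> R[i]^o) @ \oo --> (l : R[i]^o) ->
  ((fun m => euler_invz p (f m)) : nat -> R[i]^o) @ \oo --> (l : R[i]^o).
Proof.
move=> hf /cvgrPdist_lt hl; apply/cvgrPdist_lt => e /hl[N _ hN].
exists (N + h)%N => // m /= hm.
have : (N%:Z <= f m)%R by have := hf m; lia.
by case: (f m) => // n hn; apply: hN; rewrite /=; lia.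
Qed.

(** The coefficients [triple_coef p m k] are bounded uniformly in [m] and [k] and
converge, for every fixed [k], to a limit independent of [k].  The
constant is [1 / (p; p)_oo]. *)
Lemma theta_jacobi : exists kappa : R[i], forall x l, x != 0 ->
  has_sum (jacobi_term (- x)) l -> theta x p = kappa * l.
Proof.
have [A hA] := euler_prod_cvg p_lt1; have [B hB] := euler_inv_cvg p_lt1.
have [C hC] := euler_prod_bounded p_lt1; have [D hD] := euler_inv_bounded p_lt1.
exists (A * B * B) => x l x0 hl.
have nx0 : - x != 0 by rewrite oppr_eq0.
rewrite /theta; apply: (@cvg_lim R[i]^o); first exact: norm_hausdorff.
have hDz k : `|euler_invz p k| <= D%:C%C.
  case: k => n /=; first exact: hD.
  by rewrite normr0; apply: le_trans (normr_ge0 _) (hD 0%N).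
pose K : R[i] := `|A * B * B| + C%:C%C * D%:C%C * D%:C%C.
have CD0 : 0 <= C%:C%C * D%:C%C * D%:C%C :> R[i].
  by rewrite !mulr_ge0 // (le_trans (normr_ge0 _) (hC 0%N), le_trans (normr_ge0 _) (hD 0%N)).
have K0 : 0 <= K by rewrite addr_ge0.
have KE : `|K| = K by rewrite ger0_norm.
apply: (@dominated_sum _ _
  (fun m k => triple_coef p m k * jacobi_term (- x) k)
  (fun k => A * B * B * jacobi_term (- x) k)
  (fun k => K * jacobi_term (- x) k)).
- have [M hM] := jacobi_summable nx0; exists (K * M) => S.
  under eq_bigr do rewrite normrM KE.
  by rewrite -mulr_sumr ler_wpM2l.
- move=> m k; rewrite normrM [leRHS]normrM KE ler_wpM2r // /triple_coef 2!normrM.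
  rewrite /K; apply: (@le_trans _ _ (C%:C%C * D%:C%C * D%:C%C)); last by rewrite lerDr.
  by rewrite !ler_pM ?mulr_ge0.
- by move=> k; rewrite normrM [leRHS]normrM KE ler_wpM2r // lerDl.
- move=> k; apply: (@cvgM R[i] nat); last exact: cvg_cst.
  apply: (@cvgM R[i] nat); [apply: (@cvgM R[i] nat)|].
  + move/cvgrPdist_lt: hA => hA; apply/cvgrPdist_lt => e /hA[N _ hN].
    by exists N => // m /= hm; apply: hN => /=; lia.
  + by apply: (@euler_invz_cvg _ `|k|%N) => // m; lia.
  + by apply: (@euler_invz_cvg _ `|k|%N) => // m; lia.
- move=> m; have := has_sum_triple m nx0; congr has_sum.
    by apply: funext => k; rewrite /jacobi_term; ring.
  by apply: eq_bigr => j _; rewrite mulNr invrN mulrN.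
- exact: has_sumZ.
Qed.

End Jacobi.

(** * The three-term relation for the theta function *)

Section ThetaLaw.
Local Open Scope classical_set_scope.
Local Open Scope ring_scope.
Variable R : realType.

Variable p : R[i].
Hypothesis p_lt1 : `|p| < 1.

(** The pairs of integers with even and with odd sum are parametrized by
[(i + j, i - j)] and [(i + j + 1, i - j)]; the maps back round the halves, and
recover the indices only on pairs of the right parity. *)
Definition even_split (t : int * int) : int * int := (t.1 + t.2, t.1 - t.2).
Definition even_merge (t : int * int) : int * int :=
  (((t.1 + t.2) %/ 2)%Z, ((t.1 - t.2) %/ 2)%Z).
Definition odd_split (t : int * int) : int * int := (t.1 + t.2 + 1, t.1 - t.2).
Definition odd_merge (t : int * int) : int * int :=
  (((t.1 + t.2 - 1) %/ 2)%Z, ((t.1 - t.2 - 1) %/ 2)%Z).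

Lemma even_splitK : cancel even_split even_merge.
Proof. by case=> i j; rewrite /even_merge /even_split /=; congr pair; lia. Qed.

Lemma odd_splitK : cancel odd_split odd_merge.
Proof. by case=> i j; rewrite /odd_merge /odd_split /=; congr pair; lia. Qed.

Lemma parity_split (t : int * int) :
  (even_split (even_merge t) == t) = ~~ (odd_split (odd_merge t) == t).
Proof. by case: t => m n; rewrite !xpair_eqE /=; lia. Qed.

Lemma has_sum_parity (w : int * int -> R[i]) a b :
  has_sum (w \o even_split) a -> has_sum (w \o odd_split) b -> has_sum w (a + b).
Proof.
move=> ha hb.
pose w0 t := if even_split (even_merge t) == t then w t else 0.
pose w1 t := if odd_split (odd_merge t) == t then w t else 0.
have h0 : has_sum w0 a.
  apply: (has_sum_reindex even_splitK) => [t|]; rewrite /w0.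
    by case: ifP => [/eqP//|_]; rewrite eqxx.
  by move: ha; congr has_sum; apply: funext => t; rewrite even_splitK eqxx.
have h1 : has_sum w1 b.
  apply: (has_sum_reindex odd_splitK) => [t|]; rewrite /w1.
    by case: ifP => [/eqP//|_]; rewrite eqxx.
  by move: hb; congr has_sum; apply: funext => t; rewrite odd_splitK eqxx.
have := has_sumD h0 h1; congr has_sum; apply: funext => t.
by rewrite /w0 /w1 parity_split; case: (odd_split _ == t); rewrite ?addr0 ?add0r.
Qed.

Lemma has_sum_mul (T T' : choiceType) (u : T -> R[i]) (v : T' -> R[i]) a b :
  abs_summable u -> abs_summable v -> has_sum u a -> has_sum v b ->
  has_sum (fun t : T * T' => u t.1 * v t.2) (a * b).
Proof.
move=> su sv hu hv; have [c hc] := complex_has_sum (abs_summable_prod su sv).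
by rewrite -(has_sum_prod hu hv hc).
Qed.

(** The exponents of [p] are [i (i - 1)] and [i ^ 2]. *)
Definition theta_even (x : R[i]) (i : int) := p ^+ (2 * tri i) * x ^ (2 * i).
Definition theta_odd (x : R[i]) (i : int) := p ^+ (tri i + tri (- i)) * x ^ (2 * i).

(** The terms are the diagonal of an absolutely summable double series; for
[theta_odd] it is the antidiagonal. *)
Lemma theta_even_summable x : x != 0 -> abs_summable (theta_even x).
Proof.
move=> x0; have nx0 : - x != 0 by rewrite oppr_eq0.
have h := jacobi_summable p_lt1 nx0.
have inj : injective (fun i : int => (i, i)) by move=> i j [].
have := abs_summable_comp inj (abs_summable_prod h h).
congr abs_summable; apply: funext => i /=.
rewrite /jacobi_term /theta_even mul2n -addnn exprD mulrACA; congr (_ * _).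
by rewrite -expfzMl mulrNN -expr2 exprnP exprz_exp.
Qed.

Lemma theta_odd_summable x : x != 0 -> abs_summable (theta_odd x).
Proof.
move=> x0; have nx0 : - x != 0 by rewrite oppr_eq0.
have nx0' : (- x)^-1 != 0 by rewrite invr_eq0.
have h := abs_summable_prod (jacobi_summable p_lt1 nx0) (jacobi_summable p_lt1 nx0').
have inj : injective (fun i : int => (i, - i)) by move=> i j [].
have := abs_summable_comp inj h.
congr abs_summable; apply: funext => i /=.
rewrite /jacobi_term /theta_odd exprD mulrACA; congr (_ * _).
by rewrite exprz_inv opprK -expfzMl mulrNN -expr2 exprnP exprz_exp.
Qed.

(** With [(m, n) = (i + j, i - j)] the exponent
[(m (m - 1) + n (n - 1)) / 2] is [i (i - 1) + j ^ 2], and with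
[(m, n) = (i + j + 1, i - j)] it is [i ^ 2 + j (j + 1)]: in both classes the
variables [i] and [j] separate. *)
Lemma jacobi_product x y l m ax bx ay b_y : x != 0 -> y != 0 ->
  has_sum (jacobi_term p (- (x * y))) l -> has_sum (jacobi_term p (- (x / y))) m ->
  has_sum (theta_even x) ax -> has_sum (theta_odd x) bx ->
  has_sum (theta_even y) ay -> has_sum (theta_odd y) b_y ->
  l * m = ax * b_y - x / y * (bx * ay).
Proof.
move=> x0 y0 hl hm hax hbx hay hby.
have n1 : - (x * y) != 0 by rewrite oppr_eq0 mulf_neq0.
have n2 : - (x / y) != 0 by rewrite oppr_eq0 mulf_neq0 ?invr_eq0.
have hlm := has_sum_mul (jacobi_summable p_lt1 n1) (jacobi_summable p_lt1 n2) hl hm.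
apply: has_sum_unique hlm _.
have sq (z : R[i]) i : (- z) ^ (2 * i) = z ^ (2 * i).
  by rewrite -!exprz_exp -!exprnP sqrrN.
have nx0 : - x != 0 by rewrite oppr_eq0.
have exy (i j : int) : (- (x * y)) ^ (i + j) * (- (x / y)) ^ (i - j)
    = x ^ (2 * i) * y ^ (2 * j).
  rewrite -!mulNr !expfzMl mulrACA -expfzDr // exprz_inv -expfzDr //.
  by rewrite -(sq x); congr (_ ^ _ * _ ^ _); lia.
rewrite -[- (x / y * _)]mulNr; apply: has_sum_parity.
  apply: eq_has_sum (has_sum_mul (theta_even_summable x0) (theta_odd_summable y0) hax hby).
  case=> i j; rewrite /even_split /theta_even /theta_odd /jacobi_term /=.
  rewrite mulrACA [RHS]mulrACA exy -!exprD.
  congr (_ ^+ _ * _).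
  have := triE i; have := triE j; have := triE (- j); have := triE (i + j).
  have := triE (i - j); lia.
have hay' : has_sum (fun j => theta_even y (j + 1)) ay.
  apply: (@has_sum_reindex _ _ _ (fun k => k - 1) (fun k => k + 1)) => [k|k _|].
  - by rewrite subrK.
  - by rewrite addrK.
  - by move: hay; congr has_sum; apply: funext => k; rewrite subrK.
have syy : abs_summable (fun j => theta_even y (j + 1)).
  by apply: abs_summable_comp (theta_even_summable y0); apply: addIr.
apply: eq_has_sum (has_sumZ (- (x / y)) (has_sum_mul (theta_odd_summable x0) syy hbx hay')).
case=> i j; rewrite /odd_split /theta_even /theta_odd /jacobi_term /= expfzDr ?oppr_eq0 ?mulf_neq0 // expr1z.
have -> : p ^+ tri (i + j + 1) * ((- (x * y)) ^ (i + j) * - (x * y)) *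
   (p ^+ tri (i - j) * (- (x / y)) ^ (i - j)) =
   (p ^+ tri (i + j + 1) * p ^+ tri (i - j)) *
    ((- (x * y)) ^ (i + j) * (- (x / y)) ^ (i - j)) * - (x * y) by ring.
rewrite exy -exprD.
have -> : (tri (i + j + 1) + tri (i - j) = tri i + tri (- i) + 2 * tri (j + 1))%N.
  have := triE i; have := triE (- i); have := triE (j + 1); have := triE (i + j + 1).
  have := triE (i - j); lia.
rewrite (_ : 2 * (j + 1) = 2 * j + Posz 2) ?expfzDr //; last by lia.
by rewrite !(exprD p) -exprnP; field.
Qed.

Lemma theta_split : exists A B : R[i] -> R[i], forall x y, x != 0 -> y != 0 ->
  theta (x * y) p * theta (x / y) p = A x * B y - x / y * (B x * A y).
Proof.
have [kappa hk] := theta_jacobi p_lt1.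
have /choice[A hA] : forall x, exists a, x != 0 -> has_sum (theta_even x) a.
  move=> x; have [->|x0] := eqVneq x 0; first by exists 0.
  by have [a ha] := complex_has_sum (theta_even_summable x0); exists a.
have /choice[B hB] : forall x, exists a, x != 0 -> has_sum (theta_odd x) a.
  move=> x; have [->|x0] := eqVneq x 0; first by exists 0.
  by have [a ha] := complex_has_sum (theta_odd_summable x0); exists a.
exists (fun x => kappa ^+ 2 * A x), B => x y x0 y0.
have n1 : x * y != 0 by rewrite mulf_neq0.
have n2 : x / y != 0 by rewrite mulf_neq0 ?invr_eq0.
have m1 : - (x * y) != 0 by rewrite oppr_eq0.
have m2 : - (x / y) != 0 by rewrite oppr_eq0.
have [l hl] := complex_has_sum (jacobi_summable p_lt1 m1).
have [m hm] := complex_has_sum (jacobi_summable p_lt1 m2).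
rewrite (hk _ _ n1 hl) (hk _ _ n2 hm).
have := jacobi_product x0 y0 hl hm (hA x x0) (hB x x0) (hA y y0) (hB y y0).
by move=> E; rewrite mulrACA E; ring.
Qed.

(** The substitution [k -> 1 - k] in the Jacobi series. *)
Lemma theta_inv a : a != 0 -> theta a^-1 p = - (theta a p / a).
Proof.
move=> a0; have [kappa hk] := theta_jacobi p_lt1.
have na0 : - a != 0 by rewrite oppr_eq0.
have a0' : a^-1 != 0 by rewrite invr_eq0.
have [l hl] := complex_has_sum (jacobi_summable p_lt1 na0).
rewrite (hk _ _ a0 hl) (hk _ ((- a)^-1 * l) a0'); first by field.
have hl' := has_sumZ (- a)^-1 hl.
have refl (k : int) : 1 - (1 - k) = k by lia.
apply: (@has_sum_reindex _ _ _ (fun k => 1 - k) (fun k => 1 - k)).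
- exact: refl.
- by move=> k _; apply: refl.
apply: eq_has_sum hl' => k; rewrite /jacobi_term.
have -> : tri (1 - k) = tri k by have := triE k; have := triE (1 - k); lia.
rewrite -invrN exprz_inv opprB expfzDr // exprN1; ring.
Qed.

(** With [s ^+ 2 = b c], the choice [x = Q s], [y = s / b], [v = 1 / s],
[u = s d Q] turns [law3] into the Pluecker relation for the antisymmetric form
given by [theta_split]. *)
Lemma theta_lawP : theta_law (fun a : R[i] => theta a p).
Proof.
split=> [|a|Q b c d Q0 b0 c0 d0] /=.
- have := theta_inv (oner_neq0 _); rewrite invr1 mulr1 => /eqP.
  by rewrite -addr_eq0 -mulr2n mulrn_eq0 /= => /eqP.
- exact: theta_inv.
have [A [B hAB]] := theta_split.
pose s := sqrtC (b * c).
have s2 : s ^+ 2 = b * c by rewrite sqrtCK.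
have s0 : s != 0 by rewrite sqrtC_eq0 mulf_neq0.
pose x := Q * s; pose y := s / b; pose v := s^-1; pose u := s * d * Q.
have x0 : x != 0 by rewrite mulf_neq0.
have y0 : y != 0 by rewrite mulf_neq0 ?invr_eq0.
have v0 : v != 0 by rewrite invr_eq0.
have u0 : u != 0 by rewrite !mulf_neq0.
have cE : c = s ^+ 2 / b by rewrite s2; field.
have <- : x * y = c * Q by rewrite cE /x /y; field; rewrite b0.
have <- : x / y = b * Q by rewrite /x /y; field; rewrite b0 s0.
have <- : u * v = d * Q by rewrite /u /v; field.
have <- : u / v = b * c * d * Q by rewrite -s2 /u /v; field; rewrite s0.
have <- : x / v = b * c * Q by rewrite -s2 /x /v; field; rewrite s0.
have <- : u * y = c * d * Q by rewrite cE /u /y; field; rewrite b0.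
have <- : u / y = b * d * Q by rewrite /u /y; field; rewrite b0 s0.
have <- : x * u = b * c * d * Q ^+ 2 by rewrite -s2 /x /u; ring.
have E z w : z != 0 -> w != 0 -> theta (z * w) p * theta (z / w) p = A z * B w - z / w * (B z * A w).
  exact: hAB.
have bE : theta b p = - (b * theta (y * v) p).
  have -> : y * v = b^-1 by rewrite /y /v; field; rewrite b0 s0.
  by rewrite theta_inv //; field.
have cE' : theta c p = theta (y / v) p.
  by rewrite (_ : y / v = c) // [RHS]cE /y /v; field; rewrite b0 s0.
have dE : theta d p = - (d * theta (x / u) p).
  have -> : x / u = d^-1 by rewrite /x /u; field; rewrite d0 s0 Q0.
  by rewrite theta_inv //; field.
have QE : theta Q p = theta (x * v) p by rewrite (_ : x * v = Q) // /x /v; field.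
rewrite QE bE cE' dE.
have -> : theta (u / v) p * theta (x / y) p * theta (x * y) p * theta (u * v) p
  - theta (x * v) p * theta (u * y) p * theta (u / y) p * theta (x / v) p =
  (theta (x * y) p * theta (x / y) p) * (theta (u * v) p * theta (u / v) p)
  - (theta (x * v) p * theta (x / v) p) * (theta (u * y) p * theta (u / y) p) by ring.
have -> : Q * theta (x * u) p * - (b * theta (y * v) p) * theta (y / v) p *
    - (d * theta (x / u) p) = Q * b * d * (theta (x * u) p * theta (x / u) p)
     * (theta (y * v) p * theta (y / v) p) by ring.
have -> : Q * b * d = u / y by rewrite /u /y; field; rewrite b0 s0.
rewrite !E //; field.
by rewrite u0 y0 v0.
Qed.

End ThetaLaw.

(** * Specialization to the infinite products *)

Theorem theorem11p9 (R : realType) (n N : nat)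
  (q p qt pt : R[i]) (a b c d g : R[i])
  (x : 'I_n -> R[i]) (y : 'I_n.-1 -> R[i])
  (n_ge1 : (1 <= n)%N)
  (q_neq0 : q != 0) (qt_neq0 : qt != 0)
  (p_lt1 : `|p| < 1) (pt_lt1 : `|pt| < 1)
  (a_neq0 : a != 0) (b_neq0 : b != 0) (c_neq0 : c != 0) (d_neq0 : d != 0)
  (g_neq0 : g != 0)
  (x_neq0 : forall r, x r != 0) (y_neq0 : forall s, y s != 0)
  (* no denominator on the left-hand side vanishes *)
  (den_xx : forall r s : 'I_n, (r < s)%N -> theta (x r / x s) p != 0)
  (den_xxk : forall (r s : 'I_n) (m : nat), (r < s)%N -> (m <= N)%N ->
     qpfact (x r * x s) q p m != 0)
  (den_gy : forall (s : 'I_n.-1) (m : nat), (m <= N)%N ->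
     qpfacts [:: g * y s; g / y s] q p m != 0)
  (den_gx : forall (r : 'I_n) (m : nat), (m <= N)%N ->
     qpfact (g * x r) q p m != 0)
  (den_qxx : forall (r s : 'I_n) (m : nat), (m <= N)%N ->
     qpfact (q * x r / x s) q p m != 0)
  (den_a : theta a pt != 0)
  (den_K : forall m : nat, (m <= N)%N ->
     qpfacts [:: qt; a * qt / b; a * qt / c; a * qt / d;
                 b * c * d * qt ^- N / a; a * qt ^+ N.+1] qt pt m != 0)
  (* no denominator on the right-hand side vanishes *)
  (den_rhs : qpfacts [:: a * qt / b; a * qt / c; a * qt / d;
                         a * qt / (b * c * d)] qt pt N != 0) :
  \sum_(k : {ffun 'I_n -> 'I_N.+1} | (weight k <= N)%N)
    ((\prod_(r < n) \prod_(s < n | (r < s)%N)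
        (theta (q ^ ((k r)%:Z - (k s)%:Z) * x r / x s) p
         / (theta (x r / x s) p * qpfact (x r * x s) q p (k r + k s))))
     * (\prod_(s < n.-1)
          ((\prod_(r < n) qpfacts [:: x r * y s; x r / y s] q p (k r))
           / qpfacts [:: g * y s; g / y s] q p (weight k)))
     * (\prod_(r < n)
          (qpfact (g * x r) q p (weight k)
           * qpfact (g / x r) q p (weight k - k r)
           / (qpfact (g * x r) q p (k r)
              * \prod_(s < n) qpfact (q * x r / x s) q p (k r))))
     (* the index r starts at 0, so r is the r - 1 of 1-based indexing *)
     * q ^+ (\sum_(r < n) r * k r)
     * qpfact q q p (weight k)
     * (theta (a * qt ^+ (2 * weight k)) pt / theta a pt)
     * (qpfacts [:: a; b; c; d; a ^+ 2 * qt ^+ (1 + N) / (b * c * d); qt ^- N]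
          qt pt (weight k)
        / qpfacts [:: qt; a * qt / b; a * qt / c; a * qt / d;
                      b * c * d * qt ^- N / a; a * qt ^+ N.+1]
            qt pt (weight k))
     * qt ^+ weight k)
  = qpfacts [:: a * qt; a * qt / (b * c); a * qt / (b * d); a * qt / (c * d)]
      qt pt N
    / qpfacts [:: a * qt / b; a * qt / c; a * qt / d; a * qt / (b * c * d)]
        qt pt N.

Proof.
exact: (bibasic_sum (theta_lawP p_lt1) (theta_lawP pt_lt1) n_ge1 q_neq0 qt_neq0
  a_neq0 b_neq0 c_neq0 d_neq0 g_neq0 x_neq0 y_neq0 den_xx den_xxk den_gy den_gx
  den_qxx den_a den_K den_rhs).
Qed.
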